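(* Let $M$ be a countable transitive $\aleph_0$-categorical structure with no algebraicity that admits weak elimination of imaginaries, and $G=\operatorname{Aut}(M)$. Consider the action $G\curvearrowright\mathrm{LO}(M)$. Then exactly one of the following holds: (1) the action has a fixed point (i.e. there is a $G$-invariant linear order on $M$); (2) $\mu_u$ is the unique $G$-invariant Borel probability measure on $\mathrm{LO}(M)$ (so the action is uniquely ergodic).
   Context: $\mathrm{LO}(M)\subseteq 2^{M\times M}$ is the compact space of linear orders on $M$, with $a<_{g\cdot x}b\iff g^{-1}a<_x g^{-1}b$. The uniform measure $\mu_u$ is the Borel probability measure on $\mathrm{LO}(M)$ with $\mu_u(\{x: a_0<_x\dots<_x a_{k-1}\})=1/k!$ for all distinct $a_0,\dots,a_{k-1}\in M$. Transitive: $G$ acts transitively on $M$. $\aleph_0$-categorical: $G$ has finitely many orbits on each $M^k$. No algebraicity: for finite $A\subseteq M$, all orbits of the pointwise stabilizer $G_A$ on $M\setminus A$ are infinite. Weak elimination of imaginaries: for every proper open subgroup $V<G$ (pointwise convergence topology) there is a finite tuple $\bar a$ with $G_{\bar a}\le V$ and $[V:G_{\bar a}]<\infty$. *)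

(* Defs.v *)
From HB Require Import structures.
From mathcomp Require Import all_boot all_order all_algebra.
From mathcomp Require Import all_classical all_reals all_analysis.
Set Implicit Arguments. Unset Strict Implicit. Unset Printing Implicit Defensive.
Import Order.TTheory GRing.Theory Num.Theory.
Local Open Scope classical_set_scope.

Section Defs.
Variable M : countType.

(* A (relational) first-order structure on M: an arbitrary signature I with
   arities ar, and the interpretation R i of each relation symbol. *)
Definition is_aut (I : Type) (ar : I -> nat) (R : forall i, ('I_(ar i) -> M) -> Prop)
  (g : M -> M) : Prop :=
  bijective g /\ forall i (t : 'I_(ar i) -> M), R i (g \o t) <-> R i t.

Definition Aut (I : Type) (ar : I -> nat) (R : forall i, ('I_(ar i) -> M) -> Prop)
  : set (M -> M) := [set g | is_aut R g].

Definition stab (G : set (M -> M)) (A : seq M) : set (M -> M) :=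
  [set g | G g /\ forall a, a \in A -> g a = a].

Definition transitive_action (G : set (M -> M)) : Prop :=
  forall a b : M, exists2 g, G g & g a = b.

(* aleph_0-categorical: finitely many orbits of G on each M^k *)
Definition finitely_many_orbits (G : set (M -> M)) : Prop :=
  forall k : nat, exists (n : nat) (r : 'I_n -> 'I_k -> M),
    forall t : 'I_k -> M, exists (i : 'I_n) (g : M -> M),
      G g /\ forall j, g (r i j) = t j.

Definition no_algebraicity (G : set (M -> M)) : Prop :=
  forall (A : seq M) (b : M), b \notin A -> infinite_set [set g b | g in stab G A].

Definition subgroup_of (G V : set (M -> M)) : Prop :=
  [/\ V `<=` G, V id,
      (forall g h, V g -> V h -> V (g \o h)) &
      (forall g h, V g -> (forall x, g (h x) = x) -> V h)].

Definition open_in_G (G V : set (M -> M)) : Prop :=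
  forall v, V v -> exists B : seq M,
    [set g | G g /\ forall b, b \in B -> g b = v b] `<=` V.

Definition weak_EI (G : set (M -> M)) : Prop :=
  forall V : set (M -> M), subgroup_of G V -> open_in_G G V ->
    (exists g, G g /\ ~ V g) ->
    exists a : seq M, stab G a `<=` V /\
      exists (n : nat) (r : 'I_n -> M -> M), (forall i, V (r i)) /\
        forall v, V v -> exists (i : 'I_n) (h : M -> M),
          stab G a h /\ forall x, v x = r i (h x).

Definition cube : Type := {ptws (M * M) -> bool}.

Definition Bcube : Type := g_sigma_algebraType (@open cube).

(* LO(M): x (a, b) = true means a <_x b; strict linear orders *)
Definition LO : set Bcube :=
  [set x | (forall a, ~~ x (a, a)) /\
           (forall a b c, x (a, b) -> x (b, c) -> x (a, c)) /\
           (forall a b, a != b -> x (a, b) || x (b, a))].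

Definition act_inv (g : M -> M) (x : Bcube) : Bcube := fun p => x (g p.1, g p.2).

Definition fixed_point (G : set (M -> M)) (x : Bcube) : Prop :=
  forall g, G g -> act_inv g x = x.

Variable R : realType.

(* Borel probability measures on LO(M) are represented as Borel probability
   measures on 2^{MxM} concentrated on the closed set LO(M). *)
Definition on_LO (mu : probability Bcube R) : Prop := mu LO = 1%E.

(* G-invariance: mu (g . A) = mu A for Borel A included in LO(M); note that
   g . A = (act_inv g) @^-1` A. *)
Definition G_invariant (G : set (M -> M)) (mu : probability Bcube R) : Prop :=
  forall g, G g -> forall A : set Bcube, measurable A -> A `<=` LO ->
    mu ((act_inv g) @^-1` A) = mu A.

Definition is_uniform (mu : probability Bcube R) : Prop :=
  on_LO mu /\
  forall (k : nat) (a : 'I_k -> M), injective a ->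
    mu [set x | LO x /\ forall i j : 'I_k, (i < j)%N -> x (a i, a j)]
      = ((k`!%:R)^-1 : R)%:E.

End Defs.

(* Main.v *)
Require Import Defs.
From HB Require Import structures.
From mathcomp Require Import all_boot all_order all_algebra.
From mathcomp Require Import all_classical all_reals all_analysis.
From mathcomp Require Import measurable_realfun ring lra zify.
Set Implicit Arguments. Unset Strict Implicit. Unset Printing Implicit Defensive.
Import Order.TTheory GRing.Theory Num.Theory numFieldNormedType.Exports.
Local Open Scope classical_set_scope.

(* Let nu be an invariant measure on LO(M), and let H_A be the space of bounded
   measurable functions that are fixed by the pointwise stabiliser G_A, with the
   inner product of L^2(nu). For u in H_A and v in H_B the number <g u, v> takes
   finitely many values as g runs over G. Hence the orthogonal projection p_A on
   H_A is a weak limit of elements of G_A, the operator p_A p_B p_A has finitely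
   many distinct powers, and so it is idempotent. Weak elimination of imaginaries
   gives that H_A and H_B meet in H_(A /\ B), so p_A p_B = p_(A /\ B): functions
   in H_A and H_B are independent conditionally on H_(A /\ B).

   Put f_ab = p_a 1[a < b]. Independence gives f_cb <= f_ab almost surely on the
   event a < c. If f_ab really depends on b, choose a generic value t of the
   family (f_ab)_b: letting a precede c when t_ab > t_cb for some b then defines
   an invariant linear order. Otherwise b may be replaced by any b' in the
   expectation of 1[a < b] Y whenever Y is in H_B and b, b' are not in B, and
   counting gives probability 1/k! to every chain of length k. *)

(** * Ramsey's theorem for pairs *)

(** The finiteness of values rests on the finite number of G-orbits of tuples (gA, B), so it
    concerns only functions fixed by the stabiliser of a finite tuple. Bounded functions need not be
    complete in the L^2 seminorm, and a limit of finitely supported functions need not have a finite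
    support. Hence the projections cannot be taken from Hilbert space theory: each limit has to be
    shown to be bounded and again finitely supported. What makes this possible is that approximate
    equality inside a finite set of reals is equality.

    The values t_ab are read at one point x0 lying in no rational box of probability zero. If two
    points b, b' compared a and c in opposite ways, conditional independence would give positive
    probability to an event that monotonicity excludes. Ties are excluded because G is primitive on
    M.

    The alternatives exclude each other: an invariant order carries an invariant Dirac measure,
    under which a two-point chain has probability 0 or 1 instead of 1/2. *)

Section Ramsey.
Variables (C : eqType) (s : seq C) (c : nat -> nat -> C).
Hypothesis cs : forall i j, (i < j)%N -> c i j \in s.

Lemma infinite_nat_gt (A : set nat) n :
  infinite_set A -> exists2 m, A m & (n < m)%N.
Proof.
move=> Ainf; apply: contrapT => /forall2NP nA; apply: Ainf.
apply: (sub_finite_set (B := `I_n.+1)); last exact: finite_II.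
by move=> m Am /=; rewrite ltnS leqNgt; case: (nA m) => // /negP.
Qed.

Lemma infinite_pigeonhole (A : set nat) (f : nat -> C) (t : seq C) :
  infinite_set A -> (forall i, A i -> f i \in t) ->
  exists2 k, k \in t & infinite_set [set i | A i /\ f i = k].
Proof.
move=> Ainf ft; apply: contrapT => /forall2NP nk; apply: Ainf.
apply: (@sub_finite_set _ _ (\bigcup_(k in [set` t]) [set i | A i /\ f i = k])).
  by move=> i Ai; exists (f i) => //=; exact: ft.
apply: bigcup_finite => [|k /= kt]; first exact: finite_seq.
by case: (nk k) => // /contrapT.
Qed.

(** Nested infinite sets make the colour of a pair depend on its smaller element alone; a pigeonhole
    over the finite list [s] then makes it constant. *)
Lemma ramsey_pairs : exists (e : nat -> nat) (k : C),
  {homo e : i j / (i < j)%N} /\ forall i j, (i < j)%N -> c (e i) (e j) = k.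
Proof.
(* A triple holds a point, an infinite reservoir of later points, and the common colour of the pairs
   joining the point to the reservoir. *)
pose ok (p : nat * set nat * C) :=
  [/\ infinite_set p.1.2, (forall j, p.1.2 j -> (p.1.1 < j)%N /\ c p.1.1 j = p.2)
    & p.2 \in s].
have step (A : set nat) : infinite_set A ->
    exists p, [/\ ok p, A p.1.1 & p.1.2 `<=` A].
  move=> Ainf; have [i Ai _] := infinite_nat_gt 0 Ainf.
  have Binf : infinite_set [set j | A j /\ (i < j)%N].
    move=> Bfin; apply: Ainf.
    apply: (@sub_finite_set _ _ ([set j | A j /\ (i < j)%N] `|` `I_i.+1)).
      by move=> j Aj; case: (ltnP i j) => ij; [left|right].
    by rewrite finite_setU; split => //; exact: finite_II.
  have [k ks kinf] := @infinite_pigeonhole _ (c i) s Binf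
    (fun j Bj => cs Bj.2).
  exists (i, [set j | [set j | A j /\ (i < j)%N] j /\ c i j = k], k).
  by split => //= [|j [[]]//]; split => //= j [[]].
have [p0 [okp0 _ _]] := step setT infinite_nat.
have [nxt nxtP] : exists nxt, forall p, ok p ->
    [/\ ok (nxt p), p.1.2 (nxt p).1.1 & (nxt p).1.2 `<=` p.1.2].
  suff /choice[nxt H] : forall p, exists q, ok p ->
    [/\ ok q, p.1.2 q.1.1 & q.1.2 `<=` p.1.2] by exists nxt.
  move=> p; have [okp|nokp] := pselect (ok p); last by exists p.
  by have [q] := step p.1.2 (let: And3 H _ _ := okp in H); exists q.
pose P n := iter n nxt p0.
have okP n : ok (P n) by elim: n => //= n /nxtP[].
have sub i j : (i <= j)%N -> (P j).1.2 `<=` (P i).1.2.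
  elim: j => [|j IH]; first by rewrite leqn0 => /eqP ->.
  rewrite leq_eqVlt => /predU1P[->//|]; rewrite ltnS => /IH H x.
  by have [_ _ + ?] := nxtP _ (okP j); move=> /(_ x) H1; apply/H/H1.
have PP i j : (i < j)%N -> (P i).1.2 (P j).1.1.
  case: j => // j; rewrite ltnS => /sub; apply.
  by have [] := nxtP _ (okP j).
have [k _ kinf] := @infinite_pigeonhole setT (fun i => (P i).2) s infinite_nat
  (fun i _ => let: And3 _ _ H := okP i in H).
have [g gP] : exists g : nat -> nat, forall n, (n < g n)%N /\ (P (g n)).2 = k.
  suff /choice[g H] : forall n, exists m, (n < m)%N /\ (P m).2 = k by exists g.
  by move=> n; have [m [_ mk] nm] := infinite_nat_gt n kinf; exists m.
pose e n := iter n.+1 g 0.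
have emono : {homo e : i j / (i < j)%N}.
  by apply: homo_ltn => [|i]; [exact: ltn_trans|rewrite /e /= (gP _).1].
exists (fun n => (P (e n)).1.1), k; split => [i j ij|i j ij].
  by have [_ H _] := okP (e i); have [] := H _ (PP _ _ (emono _ _ ij)).
have [_ H _] := okP (e i); have [_ ->] := H _ (PP _ _ (emono _ _ ij)).
by rewrite /e /= (gP _).2.
Qed.
End Ramsey.

(** * Open subgroups and their supports *)

Section PermGroup.
Variables (M : countType) (G : set (M -> M)).
Hypotheses (G1 : G id) (GM : forall g h, G g -> G h -> G (g \o h)).
Hypothesis GV : forall g, G g -> exists h, [/\ G h, g \o h = id & h \o g = id].

Lemma stab_sub A B : {subset A <= B} -> stab G B `<=` stab G A.
Proof. by move=> AB g [Gg gB]; split => // a /AB/gB. Qed.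

Lemma stab1 A : stab G A id. Proof. by split. Qed.

Lemma stabM A g h : stab G A g -> stab G A h -> stab G A (g \o h).
Proof.
by move=> [Gg gA] [Gh hA]; split=> [|a aA]; [exact: GM|rewrite /= hA// gA].
Qed.

Lemma stabV A g : stab G A g ->
  exists h, [/\ stab G A h, g \o h = id & h \o g = id].
Proof.
move=> [Gg gA]; have [h [Gh gh hg]] := GV Gg; exists h; split => //.
by split => // a aA; rewrite -[in LHS](gA a aA); have := congr1 (@^~ a) hg.
Qed.

Lemma stab_conj A g h gh : G g -> G gh -> gh \o g = id -> stab G (map g A) h ->
  stab G A (gh \o h \o g).
Proof.
move=> Gg Ggh gK [Gh hA]; split => [|a aA].
  by apply: (GM (g := gh \o h)) => //; exact: GM.
by rewrite /= hA ?map_f//; have := congr1 (@^~ a) gK.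
Qed.

Lemma G_inj g : G g -> injective g.
Proof.
move=> /GV[h [_ _ hg]]; apply: (can_inj (g := h)) => x.
exact: (congr1 (@^~ x) hg).
Qed.

Hypotheses (noalg : no_algebraicity G) (wei : weak_EI G).

Lemma finite_orbit A b (W : set M) : finite_set W ->
  (forall g, stab G A g -> W (g b)) -> b \in A.
Proof.
move=> Wfin GW; apply: contrapT => /negP bA; apply: (noalg bA).
by apply: sub_finite_set Wfin => _ [g Ag <-]; exact: GW.
Qed.

(* S is the tuple given by [weak_EI]. It is permuted by V because the V-orbit of S
   is finite, and by [no_algebraicity] all finite G_S-orbits lie in S. *)
Lemma open_subgroup_support V : subgroup_of G V -> open_in_G G V ->
  exists S : seq M, stab G S `<=` V /\
    forall v x, V v -> x \in S -> v x \in S.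
Proof.
move=> Vsub Vopen.
have [|nV] := pselect (exists g, G g /\ ~ V g); last first.
  exists [::]; split => // g [Gg _].
  by apply: contrapT => Vg; apply: nV; exists g.
move=> /(wei Vsub Vopen)[a [aV [n [r [Vr rP]]]]].
exists a; split => // v x Vv xa.
pose W := [set r i y | i in [set: 'I_n] & y in [set` a]].
apply: (@finite_orbit _ _ W).
  by apply: finite_image2; [exact: finite_finset|exact: finite_seq].
move=> g /aV Vg; have [_ _ VM _] := Vsub.
have [i [h [[_ ha] H]]] := rP _ (VM _ _ Vg Vv).
by exists i => //; exists x => //; have := H x; rewrite /= ha.
Qed.

Hypothesis trans : transitive_action G.

(** The stabiliser V of the class of [a] contains G_a and permutes its support [S], so no
    algebraicity puts [S] inside {a}. As V also contains an element moving [a] to [b], [S] is empty;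
    hence V = G, and transitivity leaves a single class. *)
Lemma primitive (e : M -> M -> Prop) a b :
  (forall x, e x x) -> (forall x y, e x y -> e y x) ->
  (forall x y z, e x y -> e y z -> e x z) ->
  (forall g x y, G g -> e x y -> e (g x) (g y)) ->
  a <> b -> e a b -> forall x y, e x y.
Proof.
move=> eR eS eT eG ab eab.
pose V := [set g | G g /\ e (g a) a].
have Vsub : subgroup_of G V.
  split => [g []//||g h [Gg ga] [Gh ha]|g h [Gg ga] gh].
  - by split.
  - by split; [exact: GM|apply: eT ga; exact: (eG g _ _ Gg ha)].
  have [k [Gk gk kg]] := GV Gg.
  have hk : h = k.
    apply/funext => x; rewrite -[in RHS](gh x).
    by have /funeqP/(_ (h x)) /= -> := kg.
  split; rewrite hk//; have := eG _ _ _ Gk ga.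
  by have /funeqP/(_ a) /= -> := kg; exact: eS.
have aV : stab G [:: a] `<=` V.
  by move=> g [Gg ga]; split => //; rewrite ga// mem_head.
have Vopen : open_in_G G V.
  move=> v [Gv va]; exists [:: a] => g [Gg gv]; split => //.
  by rewrite gv// mem_head.
have [S [SV VS]] := open_subgroup_support Vsub Vopen.
have Sa x : x \in S -> x = a.
  move=> xS; have : x \in [:: a]; last by rewrite inE => /eqP.
  apply: (@finite_orbit _ _ [set` S]); first exact: finite_seq.
  by move=> g /aV /VS; exact.
have S0 x : x \notin S.
  apply/negP => xS; have := Sa _ xS => xa; subst x.
  have [g Gg gab] := trans a b.
  have : g a \in S by apply: VS => //; split => //; rewrite gab; exact: eS.
  by move=> /Sa; rewrite gab => /esym.
have ea x : e x a.
  have [g Gg <-] := trans a x; suff [] : V g by [].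
  by apply: SV; split => // y; rewrite (negPf (S0 y)).
by move=> x y; apply: eT (ea x) _; exact/eS.
Qed.

Lemma no_alg_avoid (A B : seq M) b : b \notin A ->
  exists2 g, stab G A g & g b \notin B.
Proof.
move=> bA; apply: contrapT => /forall2NP nB.
have /negP := bA; apply; apply: (@finite_orbit _ _ [set` B]).
  exact: finite_seq.
by move=> g Ag /=; case: (nB g) => // /negP/negPn.
Qed.

Lemma avoid_seq (A : seq M) : (exists m : M, True) -> exists b, b \notin A.
Proof.
by move=> [m _]; have [|g _ gm] := @no_alg_avoid [::] A m; [|exists (g m)].
Qed.
End PermGroup.

(** * Finite sets of reals and greedy choice *)

Local Open Scope ring_scope.

(** For inner products with values in a finite list, this turns approximation of [c] into
    equality. *)
Lemma seq_isolated (R : realDomainType) (s : seq R) (c : R) :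
  exists2 e : R, 0 < e & forall x, x \in s -> `|x - c| < e -> x = c.
Proof.
elim: s => [|y s [e e0 IH]]; first by exists 1.
have [->|yc] := eqVneq y c.
  by exists e => // x /predU1P[->//|/IH].
exists (Num.min e `|y - c|); first by rewrite lt_min e0 normr_gt0 subr_eq0.
by move=> x /predU1P[->|xs]; rewrite lt_min ?ltxx ?andbF// => /andP[/IH ->].
Qed.

Lemma inv_succ_lt (R : archiRealFieldType) (c e : R) : 0 < e ->
  exists N, forall n, (N <= n)%N -> c / n.+1%:R < e.
Proof.
move=> e0; exists (Num.bound (`|c| / e)) => n Nn.
rewrite ltr_pdivrMr ?ltr0n// (le_lt_trans (ler_norm c))//.
rewrite mulrC -ltr_pdivrMr// (@lt_le_trans _ _ (Num.bound (`|c| / e))%:R)//.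
  by rewrite archi_boundP// divr_ge0// ltW.
by rewrite ler_nat (leq_trans Nn).
Qed.

Lemma sqr_lt_norm (R : realDomainType) (x e : R) : 0 < e ->
  x ^+ 2 < e ^+ 2 -> `|x| < e.
Proof.
by move=> e0; rewrite -real_normK ?num_real// ltr_pXn2r// nnegrE// ltW.
Qed.

Lemma count_lt (T : eqType) (a b : pred T) (s : seq T) x :
  subpred a b -> x \in s -> b x -> ~~ a x -> (count a s < count b s)%N.
Proof.
move=> ab + bx ax; elim: s => // y s IH /predU1P[<-|/IH H] /=.
  by rewrite bx (negPf ax) ltnS; exact: sub_count.
have : (a y <= b y)%N by case: (a y) (ab y) => // ->.
by move: H; lia.
Qed.

Lemma finite_not_decr (R : realDomainType) (s : seq R) (f : nat -> R) :
  (forall n, f n \in s) -> exists n, f n <= f n.+1.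
Proof.
move=> fs; apply: contrapT => /forallNP H.
have {}H n : f n.+1 < f n by rewrite ltNge; apply/negP/H.
have cnt n : (n + count (fun x => (x < f n)%R) s <= size s)%N.
  elim: n => [|n IH]; first by rewrite add0n count_size.
  apply: leq_trans IH; rewrite addSnnS leq_add2l.
  by apply: (count_lt _ (fs n.+1)); rewrite ?ltxx// => x /lt_trans; apply.
by have := cnt (size s).+1; rewrite addSn ltnNge leq_addr.
Qed.

(** Dependent choice where a new term must be related to all earlier ones. The history is coded as a
    list, so that a single choice function [F] suffices. *)
Lemma greedy_seq (T : Type) (x0 : T) (P : T -> Prop) (r : T -> T -> Prop) :
  (forall (n : nat) (h : nat -> T), (forall i, (i < n)%N -> P (h i)) ->
    exists2 x, P x & forall i, (i < n)%N -> r (h i) x) ->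
  exists h : nat -> T, (forall i, P (h i)) /\
    forall i j, (i < j)%N -> r (h i) (h j).
Proof.
move=> H.
have [F FP] : exists F : seq T -> T, forall l,
    (forall i, (i < size l)%N -> P (nth x0 l i)) -> P (F l) /\
      forall i, (i < size l)%N -> r (nth x0 l i) (F l).
  suff /choice[F HF] : forall l, exists x,
    (forall i, (i < size l)%N -> P (nth x0 l i)) -> P x /\
      forall i, (i < size l)%N -> r (nth x0 l i) x by exists F.
  move=> l; have [lP|nlP] :=
    pselect (forall i, (i < size l)%N -> P (nth x0 l i)); last by exists x0.
  by have [x Px rx] := H _ _ lP; exists x.
pose L n := iter n (fun l => rcons l (F l)) [::].
have szL n : size (L n) = n by elim: n => //= n IH; rewrite size_rcons IH.
have nthL m i : (i < m)%N -> nth x0 (L m) i = F (L i).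
  elim: m => // m IH; rewrite ltnS leq_eqVlt => /predU1P[->|im] /=.
    by rewrite nth_rcons szL ltnn eqxx.
  by rewrite nth_rcons szL im IH.
have FL n : P (F (L n)).
  have [m] := ubnP n; elim: m n => // m IH n nm.
  apply: (FP _ _).1 => i; rewrite szL => im.
  by rewrite nthL//; apply: IH; exact: leq_trans im nm.
exists (fun n => F (L n)); split => // i j ij.
rewrite -(nthL j i ij); apply: (FP _ _).2; rewrite ?szL// => k kj.
by rewrite nthL.
Qed.

(** * Isometric actions with finitely many inner products *)

Section Rep.
Variables (M : countType) (G : set (M -> M)).
Hypotheses (G1 : G id) (GM : forall g h, G g -> G h -> G (g \o h)).
Hypothesis GV : forall g, G g -> exists h, [/\ G h, g \o h = id & h \o g = id].
Hypotheses (M0 : exists m : M, True) (oligo : finitely_many_orbits G).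
Hypotheses (noalg : no_algebraicity G) (wei : weak_EI G).
(** The form is only semidefinite, since functions are not identified almost everywhere;
    [null (u - v)] plays the role of equality. The predicate [bd K] abstracts a uniform bound:
    completeness is asked only of uniformly bounded Cauchy sequences. *)
Variables (R : realType) (V : lmodType R) (ip : V -> V -> R).
Variables (act : (M -> M) -> V -> V) (bd : R -> V -> Prop).
Hypotheses (ipC : forall u v, ip u v = ip v u)
  (ipDl : forall u v w, ip (u + v) w = ip u w + ip v w)
  (ipZl : forall a u w, ip (a *: u) w = a * ip u w)
  (ip_ge0 : forall u, 0 <= ip u u).
Hypotheses (act_lin : forall g, linear (act g))
  (act1 : forall v, act id v = v)
  (actM : forall g h v, act (g \o h) v = act g (act h v))
  (ip_act : forall g u v, G g -> ip (act g u) (act g v) = ip u v).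
Hypotheses (bd_ex : forall v, exists K, bd K v)
  (bd_act : forall K g v, bd K v -> bd K (act g v))
  (bd_mean : forall K (v : nat -> V) n, (forall i, bd K (v i)) ->
    bd K (n.+1%:R^-1 *: \sum_(i < n.+1) v i))
  (ip_complete : forall K (z : nat -> V), (forall n, bd K (z n)) ->
    (forall e : R, 0 < e -> exists N, forall m n, (N <= m)%N -> (N <= n)%N ->
      ip (z m - z n) (z m - z n) < e) ->
    exists z0, forall e : R, 0 < e -> exists N, forall n, (N <= n)%N ->
      ip (z n - z0) (z n - z0) < e).

Let sq v := ip v v.
Let null v := sq v = 0.

Lemma ipDr u v w : ip w (u + v) = ip w u + ip w v.
Proof. by rewrite ![ip w _]ipC ipDl. Qed.
Lemma ipZr a u w : ip w (a *: u) = a * ip w u.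
Proof. by rewrite ![ip w _]ipC ipZl. Qed.
Lemma ipNl u w : ip (- u) w = - ip u w.
Proof. by rewrite -scaleN1r ipZl mulN1r. Qed.
Lemma ipNr u w : ip w (- u) = - ip w u.
Proof. by rewrite ![ip w _]ipC ipNl. Qed.
Lemma ipBl u v w : ip (u - v) w = ip u w - ip v w.
Proof. by rewrite ipDl ipNl. Qed.
Lemma ipBr u v w : ip w (u - v) = ip w u - ip w v.
Proof. by rewrite ipDr ipNr. Qed.
Lemma ip0l w : ip 0 w = 0.
Proof. by rewrite -(scale0r w) ipZl mul0r. Qed.
Lemma ip_suml n (F : 'I_n -> V) w : ip (\sum_i F i) w = \sum_i ip (F i) w.
Proof.
by apply: (big_morph (fun v => ip v w)) => [u v|]; [exact: ipDl|exact: ip0l].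
Qed.
Lemma ip_sumr n (F : 'I_n -> V) w : ip w (\sum_i F i) = \sum_i ip w (F i).
Proof. by rewrite ipC ip_suml; apply: eq_bigr => i _; exact: ipC. Qed.

Lemma sqB u v : sq (u - v) = sq u - 2 * ip u v + sq v.
Proof. by rewrite /sq ipBl !ipBr (ipC v u); ring. Qed.

Lemma sqD_le u v : sq (u + v) <= 2 * sq u + 2 * sq v.
Proof.
have := ip_ge0 (u - v); rewrite -/(sq _) sqB.
by rewrite /sq ipDl !ipDr (ipC v u); lra.
Qed.

Lemma cauchy_schwarz u v : ip u v ^+ 2 <= sq u * sq v.
Proof.
have H t : 0 <= sq u - 2 * t * ip u v + t ^+ 2 * sq v.
  have := ip_ge0 (u - t *: v).
  by rewrite -/(sq _) sqB /sq !(ipZl, ipZr) expr2; lra.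
have [v0|v0] := eqVneq (sq v) 0.
  rewrite v0 mulr0; have [->|uv0] := eqVneq (ip u v) 0; first by rewrite expr0n.
  (* With [sq v = 0] the bound is affine in t, and this t gives it the value -1. *)
  have := H ((sq u + 1) / (2 * ip u v)); rewrite v0 mulr0 addr0.
  have -> : 2 * ((sq u + 1) / (2 * ip u v)) * ip u v = sq u + 1 by field.
  by lra.
have v_gt0 : 0 < sq v by rewrite lt_neqAle eq_sym v0 ip_ge0.
have := H (ip u v / sq v).
have -> : sq u - 2 * (ip u v / sq v) * ip u v + (ip u v / sq v) ^+ 2 * sq v =
   (sq u * sq v - ip u v ^+ 2) / sq v by field.
by rewrite pmulr_lge0 ?invr_gt0// subr_ge0.
Qed.

Lemma ip_nulll u v : null u -> ip u v = 0.
Proof.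
move=> u0; have := cauchy_schwarz u v; rewrite u0 mul0r => H.
by apply/eqP; rewrite -sqrf_eq0 eq_le H sqr_ge0.
Qed.

Lemma ip_eql u v w : null (u - v) -> ip u w = ip v w.
Proof. by move=> /(ip_nulll w); rewrite ipBl => /subr0_eq. Qed.

Lemma ip_eqr u v w : null (u - v) -> ip w u = ip w v.
Proof. by rewrite ![ip w _]ipC; exact: ip_eql. Qed.

Lemma nullB u : null (u - u).
Proof. by rewrite /null /sq subrr ip0l. Qed.
Lemma nullBC u v : null (u - v) -> null (v - u).
Proof. by rewrite /null -[v - u]opprB /sq ipNl ipNr opprK. Qed.
Lemma nullD u v : null u -> null v -> null (u + v).
Proof.
move=> u0 v0; apply/eqP; rewrite eq_le ip_ge0 andbT.
by have := sqD_le u v; rewrite u0 v0 mulr0 addr0.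
Qed.
Lemma nullB_trans u v w : null (u - v) -> null (v - w) -> null (u - w).
Proof. by move=> uv vw; have := nullD uv vw; rewrite addrA subrK. Qed.

Lemma act_sub g u v : act g (u - v) = act g u - act g v.
Proof.
have H := act_lin g (-1) v u; rewrite !scaleN1r in H.
by rewrite [u - v]addrC H addrC.
Qed.
Lemma actD g u v : act g (u + v) = act g u + act g v.
Proof. by have := act_lin g 1 u v; rewrite !scale1r. Qed.
Lemma act0 g : act g 0 = 0.
Proof. by have := act_sub g 0 0; rewrite !subrr. Qed.
Lemma actZ g a u : act g (a *: u) = a *: act g u.
Proof. by have := act_lin g a u 0; rewrite act0 !addr0. Qed.
Lemma null_act g u : G g -> null (act g u) = null u.
Proof. by move=> Gg; rewrite /null /sq ip_act. Qed.

Definition fixed A v := forall g, stab G A g -> null (act g v - v).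

Lemma fixedS A B v : {subset A <= B} -> fixed A v -> fixed B v.
Proof. by move=> AB Av g /(stab_sub AB)/Av. Qed.

Lemma fixed_eq A u v : null (u - v) -> fixed A u -> fixed A v.
Proof.
move=> uv Au g Ag; apply: (nullB_trans _ uv).
apply: nullB_trans (Au g Ag).
by rewrite -act_sub null_act; [exact: nullBC|case: Ag].
Qed.

Lemma ip_actl g h u v : G g -> h \o g = id -> g \o h = id -> G h ->
  ip (act g u) v = ip u (act h v).
Proof. by move=> Gg hg gh Gh; rewrite -(ip_act _ _ Gh) -actM hg act1. Qed.

Lemma fixed_act A g v : G g -> fixed A v -> fixed (map g A) (act g v).
Proof.
move=> Gg Av h Ah; have [k [Gk gk kg]] := GV Gg.
have := Av _ (stab_conj GM Gg Gk kg Ah).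
rewrite -(null_act _ Gg) act_sub -actM.
suff -> : g \o (k \o h \o g) = h \o g by rewrite actM.
by apply/funext => x; exact: (congr1 (@^~ (h (g x))) gk).
Qed.

Lemma fixedD A B u v : fixed A u -> fixed B v -> fixed (A ++ B) (u + v).
Proof.
move=> Au Bv g ABg; rewrite actD opprD addrACA; apply: nullD.
  by apply: Au; apply: stab_sub ABg => x; rewrite mem_cat => ->.
by apply: Bv; apply: stab_sub ABg => x; rewrite mem_cat => ->; rewrite orbT.
Qed.

Lemma fixedZ A a u : fixed A u -> fixed A (a *: u).
Proof.
move=> Au g Ag; have := Au g Ag; rewrite /null /sq => ugu.
by rewrite actZ -scalerBr ipZl ipZr ugu !mulr0.
Qed.

Lemma fixed0 A : fixed A 0.
Proof. by move=> g _; rewrite act0; exact: nullB. Qed.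

Lemma fixed_sum n (F : nat -> V) : (forall i, exists A, fixed A (F i)) ->
  exists A, fixed A (\sum_(i < n) F i).
Proof.
move=> FA; elim: n => [|n [A IH]].
  by exists [::]; rewrite big_ord0; exact: fixed0.
by have [B Fn] := FA n; exists (A ++ B); rewrite big_ord_recr; exact: fixedD.
Qed.

(** Up to null vectors the value depends only on the G-orbit of the tuple (gA, B), and there are
    finitely many such orbits. *)
Lemma finite_values A B u v : fixed A u -> fixed B v ->
  exists s : seq R, forall g, G g -> ip (act g u) v \in s.
Proof.
move=> Au Bv; have [m _] := M0.
pose k := (size A + size B)%N.
pose tup (g : M -> M) (j : 'I_k) := nth m (map g A ++ B) j.
have [n [r rP]] := oligo k.
have [val valP] : exists val : 'I_n -> R, forall i g h, G g -> G h ->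
    (forall j, h (r i j) = tup g j) -> ip (act g u) v = val i.
  suff /choice[f H] : forall i, exists x, forall g h, G g -> G h ->
      (forall j, h (r i j) = tup g j) -> ip (act g u) v = x by exists f.
  move=> i.
  have [[g [h [Gg Gh H]]]|N] := pselect (exists g h, [/\ G g, G h &
      forall j, h (r i j) = tup g j]); last first.
    by exists 0 => g h Gg Gh H; case: N; exists g, h.
  exists (ip (act g u) v) => g' h' Gg' Gh' H'.
  have [hi [Ghi hhi hih]] := GV Gh.
  have Gk : G (h' \o hi) by exact: GM.
  have kt j : (h' \o hi) (tup g j) = tup g' j.
    by rewrite -H -H' /=; congr h'; exact: (congr1 (@^~ (r i j)) hih).
  have [ki [Gki kki kik]] := GV Gk.
  have tupA a (aA : a \in A) : exists j, forall g0, tup g0 j = g0 a.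
    have ltj : (index a A < k)%N.
      by rewrite (leq_trans (_ : _ < size A)%N) ?index_mem// leq_addr.
    exists (Ordinal ltj) => g1; rewrite /tup /= nth_cat size_map index_mem aA.
    by rewrite (nth_map m) ?index_mem// nth_index.
  have tupB b (bB : b \in B) : exists j, forall g0, tup g0 j = b.
    have ltj : (size A + index b B < k)%N by rewrite ltn_add2l index_mem.
    exists (Ordinal ltj) => g1; rewrite /tup /= nth_cat size_map ltnNge leq_addr.
    by rewrite /= addKn nth_index.
  have Bk : stab G B (h' \o hi).
    by split => // b /tupB[j tj]; rewrite -[in LHS](tj g) kt tj.
  have [gi [Ggi ggi gig]] := GV Gg.
  (* The map g' is the product of [h' \o hi], [g] and this one; the first factor fixes B, hence v,
     and the last fixes A, hence u. *)
  have Al : stab G A (gi \o ki \o g').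
    split; first by do 2?[apply: GM => //].
    move=> a aA; have [j tj] := tupA _ aA.
    rewrite /= -(tj g') -kt tj.
    have /= -> := congr1 (@^~ (g a)) kik.
    exact: (congr1 (@^~ a) gig).
  have /ip_eql H1 : null (act ((h' \o hi) \o g) (act (gi \o ki \o g') u) -
      act ((h' \o hi) \o g) u).
    by rewrite -act_sub null_act; [exact: Au|exact: GM].
  have /ip_eqr H2 := Bv _ Bk.
  have -> : act g' u = act ((h' \o hi) \o g) (act (gi \o ki \o g') u).
    rewrite -actM; congr (act _ u); apply/funext => x.
    rewrite /= (_ : g (gi _) = ki (g' x)); last exact: (congr1 (@^~ _) ggi).
    exact/esym/(congr1 (@^~ (g' x)) kki).
  by rewrite H1 actM -H2 ip_act.
exists [seq val i | i : 'I_n] => g Gg.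
have [i [h [Gh rh]]] := rP (tup g).
by rewrite (valP i g h)// map_f// mem_enum.
Qed.

Definition conv (z_ : nat -> V) z := forall e : R, 0 < e ->
  exists N, forall n, (N <= n)%N -> sq (z_ n - z) < e.

Lemma conv_ip z_ z Y (e : R) : conv z_ z -> 0 < e ->
  exists N, forall n, (N <= n)%N -> `|ip (z_ n) Y - ip z Y| < e.
Proof.
move=> zz e0; have Y1 : 0 < sq Y + 1 by have := ip_ge0 Y; rewrite /sq; lra.
have [|N HN] := zz (e ^+ 2 / (sq Y + 1)); first by rewrite divr_gt0// exprn_gt0.
exists N => n /HN; rewrite ltr_pdivlMr// -ipBl => H; apply: sqr_lt_norm => //.
apply: le_lt_trans (cauchy_schwarz _ _) (le_lt_trans _ H).
by apply: ler_wpM2l; [exact: ip_ge0|lra].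
Qed.

Lemma conv_lim z_ z Y c C n0 : conv z_ z ->
  (forall n, (n0 <= n)%N -> `|ip (z_ n) Y - c| <= C / n.+1%:R) -> ip z Y = c.
Proof.
move=> zz H; apply/eqP; rewrite -subr_eq0 -normr_eq0; apply/negPn/negP => d.
have d0 : 0 < `|ip z Y - c| / 2 by rewrite divr_gt0// lt_neqAle eq_sym d/=.
have [N1 H1] := conv_ip Y zz d0; have [N2 H2] := inv_succ_lt C d0.
pose n := (n0 + N1 + N2)%N.
have := H1 n; rewrite distrC => /(_ ltac:(rewrite /n; lia)) H3.
have := H2 n ltac:(rewrite /n; lia) => H4.
have := H n ltac:(rewrite /n; lia) => H5.
have := ler_distD (ip (z_ n) Y) (ip z Y) c.
move=> H6.
by have := ltrD H3 (le_lt_trans H5 H4); rewrite -splitr ltNge H6.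
Qed.

(** The translates extracted below converge only weakly in general; their Cesàro means are Cauchy in
    norm, which is what completeness can use. *)
Definition mean (u : nat -> V) n := n.+1%:R^-1 *: \sum_(i < n.+1) u i.

Lemma fixed_mean u n : (forall i, exists A, fixed A (u i)) ->
  exists A, fixed A (mean u n).
Proof.
by move=> uA; have [A Au] := @fixed_sum n.+1 _ uA; exists A; exact: fixedZ.
Qed.

Section Spread.
Variables (u : nat -> V) (K rho kappa : R).
Hypotheses (uK : forall i, bd K (u i)) (u_sq : forall i, sq (u i) = rho)
  (u_ip : forall i j, (i < j)%N -> ip (u i) (u j) = kappa).
Let sigma := rho - kappa.

Lemma spread_ip i j : ip (u i) (u j) = kappa + sigma * (i == j)%:R.
Proof.
have [/u_ip ->|/u_ip|->] := ltngtP i j; rewrite ?mulr0 ?addr0// 1?ipC//.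
by rewrite -/(sq _) u_sq mulr1 /sigma addrC subrK.
Qed.

Lemma spread_ge0 : 0 <= sigma.
Proof.
have := ip_ge0 (u 0 - u 1%N); rewrite -/(sq _) sqB !u_sq u_ip// /sigma; lra.
Qed.

Lemma spread_mean n j :
  ip (mean u n) (u j) = kappa + sigma * (j <= n)%:R / n.+1%:R.
Proof.
rewrite /mean ipZl ip_suml.
under eq_bigr do rewrite spread_ip.
rewrite big_split /= sumr_const card_ord -mulr_sumr.
have -> : \sum_(i < n.+1) (val i == j)%:R = (j <= n)%:R :> R.
  have [jn|nj] := leqP j n; last first.
    apply: big1 => i _; case: eqP => // ij.
    by have := ltn_ord i; rewrite ltnS ij leqNgt nj.
  have jn1 : (j < n.+1)%N by [].
  rewrite (bigD1 (Ordinal jn1))//= eqxx big1 ?addr0// => i.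
  by rewrite -val_eqE /= => /negPf ->.
by rewrite -[kappa *+ _]mulr_natr; field.
Qed.

Lemma spread_mean2 m n : (m <= n)%N ->
  ip (mean u m) (mean u n) = kappa + sigma / n.+1%:R.
Proof.
move=> mn; rewrite {1}/mean ipZl ip_suml.
under eq_bigr => i _.
  rewrite ipC spread_mean (leq_trans _ mn) ?mulr1; last by rewrite -ltnS.
  over.
by rewrite sumr_const card_ord -[(_ + _) *+ _]mulr_natl mulKf.
Qed.

Lemma spread_mean_sqB m n : (m <= n)%N ->
  sq (mean u m - mean u n) <= sigma / m.+1%:R.
Proof.
move=> mn; rewrite sqB /sq !spread_mean2//.
have : 0 <= sigma / n.+1%:R by rewrite divr_ge0// spread_ge0.
move: (sigma / n.+1%:R) (sigma / m.+1%:R) => x y; lra.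
Qed.

(* The vectors u i - z are orthogonal, so Bessel's inequality makes u i converge
   weakly to z. *)
Lemma spread_bessel z Y (e : R) : (forall i, ip (u i) z = kappa) ->
  sq z = kappa -> 0 < e -> exists i, `|ip (u i) Y - ip z Y| < e.
Proof.
move=> uz zz e0; apply: contrapT => /forallNP H.
have He i : e ^+ 2 <= (ip (u i - z) Y) ^+ 2.
  rewrite ipBl leNgt; apply/negP => /(sqr_lt_norm e0); exact: H.
have woth i j : ip (u i - z) (u j - z) = sigma * (i == j)%:R.
  rewrite ipBl !ipBr spread_ip uz (ipC z (u j)) uz -/(sq z) zz; lra.
have [N /(_ _ (leqnn _))] := inv_succ_lt (sigma * sq Y) (exprn_gt0 2 e0).
rewrite ltr_pdivrMr ?ltr0n//; apply/negP; rewrite -leNgt.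
pose S := \sum_(i < N.+1) (ip (u i - z) Y) ^+ 2.
have NS : e ^+ 2 * N.+1%:R <= S.
  rewrite mulr_natr -[X in _ *+ X]card_ord -sumr_const.
  by apply: ler_sum => i _.
apply: le_trans NS _.
(* Since [ip w Y = S] and [sq w = sigma * S], Cauchy-Schwarz gives [S <= sigma * sq Y], which is
   Bessel's inequality without normalisation. *)
pose w := \sum_(i < N.+1) ip (u i - z) Y *: (u i - z).
have wY : ip w Y = S by rewrite /w ip_suml; apply: eq_bigr => i _; rewrite ipZl.
have ww : sq w = sigma * S.
  rewrite /sq {1}/w ip_suml mulr_sumr; apply: eq_bigr => i _.
  rewrite ipZl /w ip_sumr (bigD1 i)//= big1 ?addr0 => [|j ji].
    by rewrite ipZr woth eqxx mulr1 expr2 mulrA mulrC.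
  by rewrite ipZr woth eq_sym -val_eqE in ji *; rewrite (negPf ji) !mulr0.
have := cauchy_schwarz w Y; rewrite wY ww.
have S0 : 0 <= S by apply: sumr_ge0 => i _; exact: sqr_ge0.
have [->|Sn0] := eqVneq S 0.
  by rewrite mulr_ge0 ?spread_ge0 ?ip_ge0.
rewrite expr2 -!mulrA mulrCA ler_pM2l// lt_neqAle eq_sym Sn0.
exact: S0.
Qed.

Lemma spread_limit : exists z, [/\ conv (mean u) z, sq z = kappa,
  forall i, ip (u i) z = kappa &
  forall Y (e : R), 0 < e -> exists i, `|ip (u i) Y - ip z Y| < e].
Proof.
have [z zz] : exists z, conv (mean u) z.
  apply: (@ip_complete K) => [n|e e0]; first exact: bd_mean.
  have [N HN] := inv_succ_lt sigma e0; exists N => m n Nm Nn.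
  have [mn|/ltnW nm] := leqP m n.
    exact: le_lt_trans (spread_mean_sqB mn) (HN _ Nm).
  rewrite -[m in mean u m]/(id m) -opprB ipNl ipNr opprK.
  exact: le_lt_trans (spread_mean_sqB nm) (HN _ Nn).
have uz i : ip (u i) z = kappa.
  rewrite ipC; apply: (@conv_lim _ _ _ _ sigma i zz) => n ni.
  rewrite spread_mean ni mulr1 [kappa + _]addrC addrK ger0_norm//.
  by rewrite divr_ge0// spread_ge0.
have szz : sq z = kappa.
  apply: (@conv_lim _ _ _ _ 0 0 zz) => n _.
  rewrite /mean ipZl ip_suml; under eq_bigr do rewrite uz.
  by rewrite sumr_const card_ord -[kappa *+ _]mulr_natl mulKf// subrr normr0 mul0r.
by exists z; split => // Y e e0; exact: spread_bessel.
Qed.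
End Spread.

Lemma sq_eq u v : null (u - v) -> sq u = sq v.
Proof. by move=> uv; rewrite /sq (ip_eql _ uv) (ip_eqr _ uv). Qed.

Lemma sqBC u v : sq (u - v) = sq (v - u).
Proof. by rewrite !sqB (ipC v u); ring. Qed.

Lemma ip_act_swap g u v : G g -> exists2 h, G h & ip (act g u) v = ip u (act h v).
Proof. by move=> /GV[h [Gh gh hg]]; exists h => //; rewrite -(ip_act _ _ Gh) -actM hg act1. Qed.

Lemma orbit_values D u : fixed D u ->
  exists s : seq R, forall g h, G g -> G h -> ip (act g u) (act h u) \in s.
Proof.
move=> Du; have [s sP] := finite_values Du Du; exists s => g h Gg Gh.
have [k [Gk hk kh]] := GV Gh.
by rewrite -(ip_act _ _ Gk) -!actM kh act1; apply: sP; exact: GM.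
Qed.

(* The weak limits of translates of u by G_C: since inner products of fixed
   vectors take finitely many values, such limits are attained. *)
Definition wlim C u z := forall B Y, fixed B Y ->
  exists2 g, stab G C g & ip z Y = ip (act g u) Y.

Lemma wlim_refl C u : wlim C u u.
Proof. by move=> B Y _; exists id; [exact: stab1|rewrite act1]. Qed.

Lemma wlimS B C u z : {subset B <= C} -> wlim C u z -> wlim B u z.
Proof. by move=> BC uz D Y /uz[g Cg ->]; exists g => //; exact: stab_sub Cg. Qed.

Lemma wlim_trans C u v w : wlim C u v -> wlim C v w -> wlim C u w.
Proof.
move=> uv vw B Y /[dup] BY /vw[g Cg ->].
have [h [Ch gh hg]] := stabV GV Cg.
rewrite (ip_actl (h := h)) ?Cg.1 ?Ch.1//; try by [case: Cg|case: Ch].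
have [k Ck ->] := uv _ _ (fixed_act (proj1 Ch) BY).
exists (g \o k); first exact: stabM.
by rewrite -[LHS](ip_act _ _ (proj1 Cg)) -!actM gh act1.
Qed.

(** Each argument of [ip z z] is replaced in turn by a translate of u. Square norms of successive
    weak limits thus stay in one finite list, which makes the descent terminate. *)
Lemma wlim_sq C D E u z (s : seq R) : fixed D u -> fixed E z -> wlim C u z ->
  (forall g h, G g -> G h -> ip (act g u) (act h u) \in s) -> sq z \in s.
Proof.
move=> Du Ez uz sP; have [g [Gg _] zz] := uz _ _ Ez.
rewrite /sq zz ipC; have [h [Gh _] ->] := uz _ _ (fixed_act Gg Du).
exact: sP.
Qed.

(* Ramsey's theorem extracts translates with constant mutual inner product. Their
   weak limit z has this constant as square norm, and it is fixed by some G_E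
   because the distances from z to its translates take finitely many values. *)
Lemma descend C D u (h : nat -> M -> M) : fixed D u ->
  (forall i, stab G C (h i)) ->
  (forall i j, (i < j)%N -> ~ null (act (h i) u - act (h j) u)) ->
  exists z E, [/\ fixed E z, wlim C u z & sq z < sq u].
Proof.
move=> Du Ch hne; have [s sP] := orbit_values Du; have [K uK] := bd_ex u.
have Gh i : G (h i) by case: (Ch i).
have [e [k [emono ek]]] := @ramsey_pairs _ s
  (fun i j => ip (act (h i) u) (act (h j) u)) (fun i j _ => sP _ _ (Gh i) (Gh j)).
pose v i := act (h (e i)) u.
have v_sq i : sq (v i) = sq u by rewrite /sq ip_act.
have [z [vz zz vzi bes]] := @spread_limit v K (sq u) k
  (fun i => bd_act _ uK) v_sq ek.
(* A product with z is a limit of products of two translates of u; these lie in [s], so the limit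
   does too. *)
have step1 g i : G g -> ip (act g (v i)) z \in s.
  move=> Gg; rewrite ipC.
  have [d d0 dP] := seq_isolated s (ip z (act g (v i))).
  have [j Hj] := bes (act g (v i)) _ d0.
  have vs : ip (v j) (act g (v i)) \in s by rewrite /v -actM sP//; exact: GM.
  by rewrite -(dP _ vs Hj).
have step2 g : G g -> ip z (act g z) \in s.
  move=> Gg; have [d d0 dP] := seq_isolated s (ip z (act g z)).
  have vs j : ip (v j) (act g z) \in s.
    have [g' Gg' H] := ip_act_swap z (v j) Gg.
    by rewrite ipC H ipC step1.
  by have [j Hj] := bes (act g z) _ d0; rewrite -(dP _ (vs j) Hj).
exists z; have [d d0 dP] := seq_isolated s k.
(* Any g fixing this mean up to a null vector moves z by a square norm below 2 * d/4 + 2 * d/4 = d.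
   That forces [ip z (act g z)] within d of k, and d isolates k in [s]. *)
have [n /(_ _ (leqnn n)) zn] := vz (d / 4) ltac:(lra).
have [E En] : exists E, fixed E (mean v n).
  by apply: fixed_mean => i; exists (map (h (e i)) D); exact: fixed_act.
exists E; split.
- move=> g Eg; have Gg : G g by case: Eg.
  have zgz : sq (act g z - z) = 2 * k - 2 * ip z (act g z).
    by rewrite sqB [sq (act g z)]/sq ip_act// -/(sq z) zz ipC; ring.
  have H : sq (act g z - z) < d.
    rewrite (@sq_eq _ (act g (z - mean v n) + (mean v n - z))); last first.
      have := En g Eg; rewrite act_sub /null => <-.
      by congr sq; rewrite opprD !opprB addrACA addKr; congr (_ + _); rewrite addrC subrK.
    apply: le_lt_trans (sqD_le _ _) _.
    rewrite [sq (act _ _)]/sq ip_act// -/(sq _) sqBC; lra.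
  suff zgzk : ip z (act g z) = k by rewrite /null zgz zgzk subrr.
  have := ip_ge0 (act g z - z); rewrite -/(sq _) => H0.
  by apply: dP; [exact: step2|rewrite ltr_norml; apply/andP; split; lra].
- move=> B Y BY; have [s2 s2P] := finite_values Du BY.
  have [d2 d20 d2P] := seq_isolated s2 (ip z Y).
  have [i Hi] := bes Y _ d20; exists (h (e i)) => //.
  by apply/esym/d2P => //; exact: s2P.
(* If k were equal to [sq u], the distinct translates v 0 and v 1 would differ by a null vector. *)
- have := hne _ _ (emono 0 1%N isT); rewrite /null -/(v 0) -/(v 1%N).
  rewrite sqB !v_sq ek// zz => H; rewrite ltNge; apply/negP => H'.
  apply: H; apply/eqP; rewrite eq_le; apply/andP; split; first by lra.
  by have := ip_ge0 (v 0 - v 1%N); rewrite -/(sq _) sqB !v_sq ek.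
Qed.

Definition vstab w : set (M -> M) := [set g | G g /\ null (act g w - w)].

Lemma vstab_subgroup w : subgroup_of G (vstab w).
Proof.
split => [g []//||g h [Gg gw] [Gh hw]|g h [Gg gw] gh].
- by split; [exact: G1|rewrite act1; exact: nullB].
- split; first exact: GM.
  by apply: nullB_trans gw; rewrite actM -act_sub null_act.
have [k [Gk gk kg]] := GV Gg.
have -> : h = k.
  apply/funext => x; rewrite -[in RHS](gh x).
  exact/esym/(congr1 (@^~ (h x)) kg).
split => //; rewrite -(null_act _ Gg) act_sub -actM gk act1.
exact: nullBC.
Qed.

Lemma vstab_open D w : fixed D w -> open_in_G G (vstab w).
Proof.
move=> Dw v [Gv vw]; exists D => g [Gg gv]; split => //.
have [k [Gk vk kv]] := GV Gv.
have /Dw kgw : stab G D (k \o g).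
  split; first exact: GM.
  by move=> a aD; rewrite /= gv//; exact: (congr1 (@^~ a) kv).
have : null (act v (act (k \o g) w - w)) by rewrite null_act.
rewrite act_sub -actM compA vk => H; exact: nullB_trans H vw.
Qed.

(** Weak elimination of imaginaries for vectors: the stabiliser of [w] modulo null vectors is an
    open subgroup, and its support is a canonical finite support of [w]. *)
Lemma vstab_support D w : fixed D w -> exists S : seq M,
  fixed S w /\ forall v x, G v -> null (act v w - w) -> x \in S -> v x \in S.
Proof.
move=> Dw.
have [S [SV VS]] := open_subgroup_support noalg wei (vstab_subgroup w)
  (vstab_open Dw).
by exists S; split=> [g /SV[]//|v x Gv vw]; apply: VS.
Qed.

(** Both G_A and G_B permute the finite support of [w], so by no algebraicity it lies in A and in
    B. *)
Lemma fixedI A B w : fixed A w -> fixed B w -> fixed [seq x <- A | x \in B] w.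
Proof.
move=> Aw Bw; have [S [Sw VS]] := vstab_support Aw.
apply: fixedS Sw => x xS; rewrite mem_filter.
apply/andP; split; apply: (finite_orbit noalg (W := [set` S])) => //.
- by move=> g Bg /=; apply: VS => //; [case: Bg|exact: Bw].
- by move=> g Ag /=; apply: VS => //; [case: Ag|exact: Aw].
Qed.

(** G_C moves the support of u only within the finitely many sets h_i S, so every point of S has a
    finite G_C-orbit and lies in C. *)
Lemma fixed_finite_orbit C D u n (h : nat -> M -> M) : fixed D u ->
  (forall i, (i < n)%N -> stab G C (h i)) ->
  (forall g, stab G C g -> exists2 i, (i < n)%N &
    null (act g u - act (h i) u)) -> fixed C u.
Proof.
move=> Du Ch hfin; have [S [Su VS]] := vstab_support Du.
apply: fixedS Su => x xS.
pose W := [set h i y | i in `I_n & y in [set` S]].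
apply: (finite_orbit noalg (W := W)).
  by apply: finite_image2; [exact: finite_II|exact: finite_seq].
move=> g Cg; have [i ilt gi] := hfin _ Cg; exists i => //.
have [k [Gk hk kh]] := GV (proj1 (Ch _ ilt)).
exists (k (g x)); last exact: (congr1 (@^~ (g x)) hk).
apply: (VS (k \o g)) => //; first by apply: GM => //; case: Cg.
rewrite actM -[X in _ - X]act1 -kh (actM k (h i)) -act_sub null_act//.
Qed.

(* A weak limit of minimal norm has a finite orbit by [descend], hence is fixed. *)
Lemma projection C D u : fixed D u -> exists z, fixed C z /\ wlim C u z.
Proof.
move=> Du; have [s sP] := orbit_values Du.
(* The induction is on the number of entries of [s] below [sq z], which drops at each descent. *)
suff H n z E : fixed E z -> wlim C u z -> (count (fun x => (x < sq z)%R) s < n)%N ->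
    exists z, fixed C z /\ wlim C u z.
  exact: (H _ u D Du (wlim_refl _ _) (ltnSn _)).
elim: n z E => // n IH z E Ez uz; rewrite ltnS => zn.
have [[m [h [Ch hfin]]]|ninf] := pselect (exists m (h : nat -> M -> M),
    (forall i, (i < m)%N -> stab G C (h i)) /\
    (forall g, stab G C g -> exists2 i, (i < m)%N &
       null (act g z - act (h i) z))).
  by exists z; split => //; exact: (fixed_finite_orbit Ez Ch hfin).
have [m h Ch|h [Ch hne]] := @greedy_seq _ id (stab G C)
    (fun g h => ~ null (act g z - act h z)).
  apply: contrapT => nx; apply: ninf; exists m, h; split => // g Cg.
  apply: contrapT => ng; apply: nx; exists g => // i im /nullBC gi.
  by apply: ng; exists i.
have [w [F [Fw zw wz]]] := descend Ez Ch hne.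
have uw := wlim_trans uz zw.
apply: (IH w F) => //; apply: leq_trans _ zn.
have ws := wlim_sq Du Fw uw sP.
by apply: (count_lt _ ws wz); rewrite ?ltxx// => x /lt_trans; apply.
Qed.

(** A translation by G_C is invisible to a vector fixed by G_C. So a weak limit that is itself fixed
    by G_C is the orthogonal projection of u. *)
Lemma projectionE C u z Y : wlim C u z -> fixed C Y -> ip z Y = ip u Y.
Proof.
move=> uz CY; have [g Cg ->] := uz _ _ CY.
have [h [Ch gh hg]] := stabV GV Cg.
rewrite (ip_actl (h := h)) ?(proj1 Cg) ?(proj1 Ch)//.
  by apply: ip_eqr; exact: CY.
by case: Cg.
by case: Ch.
Qed.

(** The vector w is p_B u, and the claim is that it lies in the smaller space H_(A /\ B). It
    suffices that p_A p_B u = p_B u up to a null vector, for then p_B u belongs to both H_A and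
    H_B. *)
Lemma proj_commute A B u : fixed A u -> exists w,
  fixed [seq x <- A | x \in B] w /\ forall Y, fixed B Y -> ip w Y = ip u Y.
Proof.
move=> Au.
have [p pP] : exists p : seq M -> V -> V, forall C D v, fixed D v ->
    fixed C (p C v) /\ wlim C v (p C v).
  suff /choice[p pP] : forall Cv, exists z, forall D, fixed D Cv.2 ->
      fixed Cv.1 z /\ wlim Cv.1 Cv.2 z.
    by exists (fun C v => p (C, v)) => C D v Dv; have := pP (C, v) D Dv.
  move=> [C v] /=; have [[D Dv]|nv] := pselect (exists D, fixed D v).
    by have [z zP] := projection C Dv; exists z.
  by exists 0 => D Dv; case: nv; exists D.
(* The inner product of U n and U m depends only on n + m and takes finitely many
   values, so U becomes stationary; by self-adjointness it is so from U 1 on. *)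
pose U n := iter n (fun v => p A (p B v)) u; pose W n := p B (U n).
have UA n : fixed A (U n).
  elim: n => //= n IH; have [Bp _] := pP B A _ IH.
  by have [] := pP A B _ Bp.
have WB n : fixed B (W n) by have [] := pP B A _ (UA n).
have WU n Y : fixed B Y -> ip (W n) Y = ip (U n) Y.
  by apply: projectionE; have [] := pP B A _ (UA n).
have UW n Y : fixed A Y -> ip (U n.+1) Y = ip (W n) Y.
  by apply: projectionE; have [] := pP A B _ (WB n).
have UUS n m : ip (U n.+1) (U m) = ip (U n) (U m.+1).
  by rewrite UW// [RHS]ipC UW// [LHS]ipC -WU// [RHS]ipC -WU// ipC.
pose s k := ip u (U k).
have UU n m : ip (U n) (U m) = s (n + m)%N.
  by elim: n m => // n IH m; rewrite UUS IH addSnnS.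
have WUs n m : ip (W n) (U m) = s (n + m).+1 by rewrite -UW// UU addSn.
have WW n m : ip (W n) (W m) = s (n + m).+1 by rewrite WU// ipC WUs addnC.
(* Consequently [s k] is the inner product of u with one of its translates. *)
have Uu k : wlim [::] u (U k).
  elim: k => [|k IH]; first exact: wlim_refl.
  apply: (wlim_trans IH); apply: (@wlim_trans _ _ (W k)).
    by apply: (@wlimS _ B) => //; have [] := pP B A _ (UA k).
  by apply: (@wlimS _ A) => //; have [] := pP A B _ (WB k).
have [S SP] := orbit_values Au.
have sS k : s k \in S.
  have [g [Gg _] H] := Uu k _ _ Au.
  by rewrite /s ipC H -[X in ip _ X]act1 SP.
have s1 n : s (n + n).+1 <= s (n + n)%N.
  rewrite -subr_ge0; have := ip_ge0 (U n - W n); rewrite -/(sq _) sqB.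
  rewrite /sq UU WW [ip (U n) _]ipC WUs; lra.
have s2 n : s (n + n).+2 <= s (n + n).+1.
  rewrite -subr_ge0; have := ip_ge0 (U n.+1 - W n); rewrite -/(sq _) sqB.
  rewrite /sq UU WW [ip (U n.+1) _]ipC WUs !addSn !addnS; lra.
pose d k := s k - 2 * s k.+1 + s k.+2.
pose Z n := U n - U n.+1.
have ZZ n m : ip (Z n) (Z m) = d (n + m)%N.
  by rewrite /Z ipBl !ipBr !UU /d !addSn !addnS; ring.
(* A null vector Z (n+1) is orthogonal to Z (n-1), whose product with it is the square norm of Z n;
   so nullity descends to Z 1. *)
have d2 n : d (n.+1 + n.+1)%N = 0 -> d 2 = 0.
  elim: n => // n IH H; apply: IH; rewrite addSnnS addnC -ZZ.
  by apply: ip_nulll; rewrite /null /sq ZZ.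
have [n Hn] := finite_not_decr (fun n => sS (n.+1 + n.+1)%N).
have sn1 := s1 n.+1; have sn2 := s2 n.+1.
rewrite !addSn !addnS in Hn sn1 sn2.
have /d2 dd2 : d (n.+1 + n.+1)%N = 0.
  by rewrite /d !addSn !addnS; apply/eqP; rewrite eq_le; apply/andP; split; lra.
have dk k : s k.+1 - s k.+2 = s 1%N - s 2%N.
  elim: k => // k <-.
  have : d (1 + k)%N = 0 by rewrite -ZZ; apply: ip_nulll; rewrite /null /sq ZZ.
  rewrite /d add1n; lra.
have s12 : s 1%N = s 2%N.
  have := dk (n + n).+1; have : s (n + n).+2 = s (n + n).+3 by lra.
  lra.
have WU0 : null (U 1%N - W 0).
  by rewrite /null sqB /sq UU WW [ip (U _) _]ipC WUs s12 /=; ring.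
exists (W 0); split; last by move=> Y; exact: WU.
by apply: fixedI (WB 0); apply: fixed_eq WU0 (UA 1%N).
Qed.
End Rep.

(** * Bounded measurable functions *)

Section BoundedMeasurable.
Context d (T : measurableType d) (R : realType).

Definition bounded_measurable : {pred T -> R} :=
  [pred f : T -> R | `[< measurable_fun setT f /\ exists K, forall x, `|f x| <= K >]].

Lemma bounded_measurableP (f : T -> R) : reflect
  (measurable_fun setT f /\ exists K, forall x, `|f x| <= K)
  (f \in bounded_measurable).
Proof. by rewrite inE; exact: asboolP. Qed.

Lemma bounded_measurable_submod : submod_closed bounded_measurable.
Proof.
split.
  apply/bounded_measurableP; split; first exact: measurable_cst.
  by exists 0 => x; rewrite normr0.
move=> a f g /bounded_measurableP[mf [K fK]] /bounded_measurableP[mg [L gL]].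
apply/bounded_measurableP; split.
  by apply: measurable_funD => //; exact: measurable_funM.
exists (`|a| * K + L) => x; apply: le_trans (ler_normD _ _) _.
by rewrite lerD// normrM ler_wpM2l.
Qed.

HB.instance Definition _ := GRing.isSubmodClosed.Build _ _ bounded_measurable
  bounded_measurable_submod.

(** Bundling gives the [lmodType] structure required by the abstract theory of isometric actions. *)
Record bmf := Bmf { bmf_val :> T -> R; _ : bmf_val \in bounded_measurable }.
HB.instance Definition _ := [isSub for bmf_val].
HB.instance Definition _ := [Choice of bmf by <:].
HB.instance Definition _ := [SubChoice_isSubLmodule of bmf by <:].

Lemma bmf_measurable (f : bmf) : measurable_fun setT f.
Proof. by have /bounded_measurableP[] := valP f. Qed.

Lemma bmf_bounded (f : bmf) : exists K, forall x, `|f x| <= K.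
Proof. by have /bounded_measurableP[] := valP f. Qed.

Lemma bmf_mul_subproof (f g : bmf) : (fun x => f x * g x) \in bounded_measurable.
Proof.
have [K fK] := bmf_bounded f; have [L gL] := bmf_bounded g.
apply/bounded_measurableP; split.
  by apply: measurable_funM; exact: bmf_measurable.
by exists (K * L) => x; rewrite normrM ler_pM.
Qed.
Definition bmf_mul f g := Bmf (bmf_mul_subproof f g).

Lemma bmf_comp_subproof (h : T -> T) (f : bmf) : measurable_fun setT h ->
  f \o h \in bounded_measurable.
Proof.
have [K fK] := bmf_bounded f => mh.
apply/bounded_measurableP; split; last by exists K => x /=.
by apply: measurableT_comp => //; exact: bmf_measurable.
Qed.
Definition bmf_comp h f (mh : measurable_fun setT h) := Bmf (bmf_comp_subproof f mh).

Lemma bmf_test_subproof (b : T -> bool) : measurable_fun setT b ->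
  (fun x => (b x)%:R : R) \in bounded_measurable.
Proof.
move=> mb; apply/bounded_measurableP; split; last first.
  by exists 1 => x; case: (b x); rewrite ?normr0 ?normr1.
by apply: (measurableT_comp (f := fun b : bool => b%:R : R)).
Qed.
Definition bmf_test b (mb : measurable_fun setT b) := Bmf (bmf_test_subproof mb).

Lemma bmf_abs_subproof (f : bmf) : (fun x => `|f x|) \in bounded_measurable.
Proof.
have [K fK] := bmf_bounded f; apply/bounded_measurableP; split.
  by apply: measurableT_comp => //; exact: bmf_measurable.
by exists K => x; rewrite normr_id.
Qed.
Definition bmf_abs f := Bmf (bmf_abs_subproof f).

Lemma bmf_cst_subproof (a : R) : (fun=> a) \in bounded_measurable.
Proof.
by apply/bounded_measurableP; split; [exact: measurable_cst|exists `|a|].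
Qed.
Definition bmf_cst a := Bmf (bmf_cst_subproof a).

Variable P : probability T R.
Definition Ex (f : T -> R) : R := \int[P]_x f x.

Lemma bmf_integrable (f : bmf) : P.-integrable setT (EFin \o f).
Proof.
apply: measurable_bounded_integrable => //.
- by apply: (le_lt_trans (probability_le1 _ _)) => //; exact: ltry.
- exact: bmf_measurable.
have [K fK] := bmf_bounded f; exists K; split; first exact: num_real.
by move=> L KL x _; apply: le_trans (fK x) (ltW KL).
Qed.

Lemma ExD (f g : bmf) : Ex (fun x => f x + g x) = Ex f + Ex g.
Proof. by apply: RintegralD => //; exact: bmf_integrable. Qed.
Lemma ExZ a (f : bmf) : Ex (fun x => a * f x) = a * Ex f.
Proof. by apply: RintegralZl => //; exact: bmf_integrable. Qed.
Lemma Ex_ge0 (f : T -> R) : (forall x, 0 <= f x) -> 0 <= Ex f.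
Proof. by move=> f0; apply: Rintegral_ge0. Qed.
Lemma Ex_cst a : Ex (fun=> a) = a.
Proof.
rewrite /Ex Rintegral_cst// -[RHS]mulr1; congr (_ * _).
exact: (congr1 fine (probability_setT P)).
Qed.
Lemma Ex_le (f g : bmf) : (forall x, f x <= g x) -> Ex f <= Ex g.
Proof. by move=> fg; apply: le_Rintegral => //; exact: bmf_integrable. Qed.
Lemma Ex_ae (f g : bmf) : {ae P, forall x, f x = g x} -> Ex f = Ex g.
Proof.
move=> fg; rewrite /Ex /Rintegral; congr fine.
apply: ae_eq_integral => //; try by apply/measurable_EFinP; exact: bmf_measurable.
by apply: filterS fg => x fgx _; rewrite fgx.
Qed.
Lemma Ex_eq0 (f : bmf) : (forall x, 0 <= f x) -> Ex f = 0 ->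
  {ae P, forall x, f x = 0}.
Proof.
move=> f0 Ef.
have : (\int[P]_x `|(f x)%:E| = 0)%E.
  under eq_integral do rewrite gee0_abs ?lee_fin//.
  rewrite -[LHS]fineK; first by rewrite [fine _]Ef.
  by apply: integrable_fin_num => //; exact: bmf_integrable.
have mf : measurable_fun setT (EFin \o f).
  by apply/measurable_EFinP; exact: bmf_measurable.
by move=> /(ae_eq_integral_abs P measurableT mf); apply: filterS => x /(_ I) [].
Qed.

Definition inner (f g : bmf) := Ex (bmf_mul f g).

Lemma bmfDE (f g : bmf) x : (f + g : bmf) x = f x + g x.
Proof. by []. Qed.
Lemma bmfBE (f g : bmf) x : (f - g : bmf) x = f x - g x.
Proof. by []. Qed.
Lemma bmfZE a (f : bmf) x : (a *: f : bmf) x = a * f x.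
Proof. by []. Qed.

Lemma ip_sym f g : inner f g = inner g f.
Proof. by rewrite /inner; congr Ex; apply/funext => x /=; rewrite mulrC. Qed.
Lemma ip_add f g h : inner (f + g) h = inner f h + inner g h.
Proof.
rewrite /inner -ExD; congr Ex; apply/funext => x.
by rewrite /= -mulrDl.
Qed.
Lemma ip_scale a f h : inner (a *: f) h = a * inner f h.
Proof. by rewrite /inner -ExZ; congr Ex; apply/funext => x; rewrite /= -mulrA. Qed.
Lemma ip_ge0 f : 0 <= inner f f.
Proof. by apply: Ex_ge0 => x; rewrite /= -expr2 sqr_ge0. Qed.
Lemma ip_eq0 f : inner f f = 0 -> {ae P, forall x, f x = 0}.
Proof.
move=> /Ex_eq0 H; have {}/H : forall x, 0 <= bmf_mul f f x.
  by move=> x; rewrite /= -expr2 sqr_ge0.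
by apply: filterS => x /= /eqP; rewrite -expr2 sqrf_eq0 => /eqP.
Qed.

Definition bounded_by K (f : bmf) := forall x, `|f x| <= K.

Lemma bounded_by_mean K (f : nat -> bmf) n : (forall i, bounded_by K (f i)) ->
  bounded_by K (n.+1%:R^-1 *: \sum_(i < n.+1) f i).
Proof.
move=> fK x; rewrite bmfZE normrM ger0_norm ?invr_ge0// mulrC ler_pdivrMr//.
have -> : (\sum_(i < n.+1) f i : bmf) x = \sum_(i < n.+1) f i x.
  by apply: (big_morph (fun h : bmf => h x)).
apply: le_trans (ler_norm_sum _ _ _) _.
rewrite mulr_natr -[X in _ *+ X]card_ord -sumr_const; apply: ler_sum => i _.
exact: fK.
Qed.

Section Complete.
Variables (K : R) (y : nat -> bmf).
Hypotheses (yK : forall n, bounded_by K (y n)).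
Hypothesis yC : forall n, inner (y n.+1 - y n) (y n.+1 - y n) <= 4^-1 ^+ n.

Let w x := limn_sup (fun n => y n x).

Lemma y_ub x : has_ubound (range (fun n => y n x)).
Proof. by exists K => _ [n _ <-]; apply: le_trans (ler_norm _) (yK n x). Qed.
Lemma y_lb x : has_lbound (range (fun n => y n x)).
Proof. by exists (- K) => _ [n _ <-]; have := yK n x; rewrite ler_norml => /andP[]. Qed.

Lemma limn_sup_between x k a b : (forall m, (k <= m)%N -> a <= y m x <= b) ->
  a <= w x <= b.
Proof.
move=> H; have cv := cvg_sups_inf (y_ub x) (y_lb x).
have cvs : cvgn (sups (fun n => y n x)) by apply/cvg_ex; eexists; exact: cv.
apply/andP; split.
  apply: limr_ge => //; apply: nearW => n.
  have /andP[H1 _] := H (maxn n k) (leq_maxr _ _).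
  apply: le_trans H1 _; apply: ub_le_sup; first exact/has_ubound_sdrop/y_ub.
  by exists (maxn n k) => //=; exact: leq_maxl.
apply: limr_le => //; near=> n; apply: ge_sup.
  by exists (y n x); exists n => //=.
move=> _ [m /= nm <-]; have km : (k <= m)%N.
  by apply: leq_trans nm; near: n; exists k.
by have /andP[] := H m km.
Unshelve. all: by end_near.
Qed.

Lemma w_bmf : w \in bounded_measurable.
Proof.
apply/bounded_measurableP; split.
  apply: measurable_fun_limn_sup => [x _|x _|n]; [exact: y_ub|exact: y_lb|].
  exact: bmf_measurable.
exists K => x; rewrite ler_norml; apply: (@limn_sup_between x 0) => m _.
by rewrite -ler_norml; exact: yK.
Qed.

(** With c = 2^n, integrate |t| <= (c/2) t^2 + 1/(2c), which is (c|t| - 1)^2 >= 0 rearranged; both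
    terms contribute at most 2^-n / 2. *)
Lemma Ex_step n : Ex (fun x => `|y n.+1 x - y n x|) <= 2^-1 ^+ n.
Proof.
pose u := y n.+1 - y n; pose c : R := 2 ^+ n.
have c0 : 0 < c by rewrite exprn_gt0.
have cV : 2^-1 ^+ n = c^-1 by rewrite exprVn.
have c4 : 4^-1 ^+ n = (c * c)^-1.
  by rewrite exprVn /c -exprMn; congr (_ ^+ n)^-1; lra.
apply: (@le_trans _ _
  (Ex ((c / 2) *: bmf_mul u u + bmf_cst (c^-1 / 2) : bmf))).
  apply: (@Ex_le (bmf_abs u) ((c / 2) *: bmf_mul u u + bmf_cst (c^-1 / 2))) => x.
  rewrite bmfDE bmfZE /=; set t := (X in `|X| <= _).
  have -> : t * t = `|t| * `|t| by rewrite -!expr2 real_normK ?num_real.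
  have -> : c / 2 * (`|t| * `|t|) + c^-1 / 2 =
      `|t| + (2 * c)^-1 * (c * `|t| - 1) ^+ 2 by field; exact: lt0r_neq0.
  by rewrite lerDl mulr_ge0 ?sqr_ge0// invr_ge0 mulr_ge0// ltW.
have -> : Ex ((c / 2) *: bmf_mul u u + bmf_cst (c^-1 / 2) : bmf) =
    c / 2 * inner u u + c^-1 / 2.
  rewrite -[in RHS](Ex_cst (c^-1 / 2)).
  have /= := @ExD ((c / 2) *: bmf_mul u u) (bmf_cst (c^-1 / 2)).
  by move=> ->; rewrite /inner -ExZ.
have := yC n; rewrite cV c4 -/u => H.
have -> : c^-1 = c / 2 * (c * c)^-1 + c^-1 / 2 by field; exact: lt0r_neq0.
have -> : (c / 2 * (c * c)^-1 + c^-1 / 2)/2 = c^-1 /2 by field; exact: lt0r_neq0.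
by rewrite lerD2r ler_wpM2l// divr_ge0// ltW.
Qed.

(* Bounding the upper limit itself avoids proving almost sure convergence. *)
Lemma limn_sup_series x k : (`|y k x - w x|%:E <=
  \sum_(j <oo) `|y (k + j).+1 x - y (k + j) x|%:E)%E.
Proof.
set S := (\sum_(j <oo) _)%E.
have S0 : (0 <= S)%E by apply: nneseries_ge0 => j _ _; rewrite lee_fin.
case Ss : S S0 => [s| |] S0 //; last exact: leey.
rewrite lee_fin distrC ler_distl; apply: (@limn_sup_between x k) => m km.
rewrite -ler_distl -lee_fin -Ss -(subnKC km).
apply: (@le_trans _ _ (\sum_(0 <= j < m - k)
    `|y (k + j).+1 x - y (k + j) x|%:E)%E); last first.
  by apply: nneseries_lim_ge => j _ _; rewrite lee_fin.
elim: (m - k)%N => [|n IH].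
  by rewrite addn0 subrr normr0 big_nil.
rewrite big_nat_recr//=; apply: le_trans (leeD IH (lexx _)).
rewrite -EFinD lee_fin addnS; apply: le_trans (ler_distD (y (k + n)%N x) _ _) _.
by rewrite addrC.
Qed.

Definition bmf_limsup := Bmf w_bmf.

Lemma Ex_limsup k : Ex (fun x => `|y k x - w x|) <= 2 * 2^-1 ^+ k.
Proof.
have intf : P.-integrable setT (EFin \o bmf_abs (y k - bmf_limsup)).
  exact: bmf_integrable.
rewrite -lee_fin /Ex /Rintegral fineK; last exact: (integrable_fin_num _ intf).
have mstep j : measurable_fun setT (fun x => `|y (k + j).+1 x - y (k + j) x|%:E).
  apply/measurable_EFinP.
  exact: (bmf_measurable (bmf_abs (y (k + j).+1 - y (k + j)))).
apply: (@le_trans _ _ (\int[P]_x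
    (\sum_(j <oo) `|y (k + j).+1 x - y (k + j) x|%:E))%E).
  apply: ge0_le_integral => //.
  - by apply/measurable_EFinP; exact: (bmf_measurable (bmf_abs (y k - bmf_limsup))).
  - by apply: (ge0_emeasurable_sum (P := xpredT)) => // j x _ _; rewrite lee_fin.
  - by move=> x _; exact: limn_sup_series.
rewrite integral_nneseries//.
have Ij j : (\int[P]_x `|y (k + j).+1 x - y (k + j) x|%:E <=
    (2^-1 ^+ (k + j))%:E)%E.
  have intj : P.-integrable setT (EFin \o bmf_abs (y (k + j).+1 - y (k + j))).
    exact: bmf_integrable.
  rewrite -[leLHS]fineK; last exact: (integrable_fin_num _ intj).
  by rewrite lee_fin; exact: Ex_step.
apply: lime_le.
  by apply: is_cvg_nneseries => j _ _; apply: integral_ge0 => x _; rewrite lee_fin.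
apply: nearW => n.
(* The closed form of the geometric sum makes the induction on n go through. *)
apply: (@le_trans _ _ (2 * 2^-1 ^+ k - 2 * 2^-1 ^+ (k + n))%:E); last first.
  by rewrite lee_fin gerBl mulr_ge0// exprn_ge0// invr_ge0.
elim: n => [|n IH]; first by rewrite big_nil addn0 subrr.
rewrite big_nat_recr//=; apply: le_trans (leeD IH (Ij n)) _.
rewrite -EFinD lee_fin addnS exprS; lra.
Qed.

(** Both functions are bounded by K, so the square of their difference is at most 2K times its
    absolute value: the L^1 estimate becomes an L^2 estimate. *)
Lemma ip_limsup k :
  inner (y k - bmf_limsup) (y k - bmf_limsup) <= 4 * K * 2^-1 ^+ k.
Proof.
pose u := bmf_abs (y k - bmf_limsup).
have wK x : `|w x| <= K.
  rewrite ler_norml; apply: (@limn_sup_between x 0) => m _.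
  by rewrite -ler_norml; exact: yK.
have K0 : 0 <= K by apply: le_trans (yK 0 point).
apply: (@le_trans _ _ (Ex ((2 * K) *: u))).
  apply: (@Ex_le (bmf_mul (y k - bmf_limsup) (y k - bmf_limsup)) ((2 * K) *: u)).
  move=> x; rewrite bmfZE /=.
  rewrite -expr2 -real_normK ?num_real// expr2 ler_wpM2r//.
  apply: le_trans (ler_normB _ _) _.
  have := yK k x; have := wK x; lra.
have -> : Ex ((2 * K) *: u) = 2 * K * Ex u by rewrite -ExZ.
have := @ler_wpM2l _ (2 * K) _ _ _ (Ex_limsup k); rewrite mulr_ge0// => /(_ isT) H.
apply: le_trans H _; lra.
Qed.
End Complete.

Lemma ip_complete K (z : nat -> bmf) : (forall n, bounded_by K (z n)) ->
  (forall e : R, 0 < e -> exists N, forall m n, (N <= m)%N -> (N <= n)%N ->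
    inner (z m - z n) (z m - z n) < e) ->
  exists z0, forall e : R, 0 < e -> exists N, forall n, (N <= n)%N ->
    inner (z n - z0) (z n - z0) < e.
Proof.
move=> zK zC.
have [N NP] : exists N : nat -> nat, forall k m n, (N k <= m)%N -> (N k <= n)%N ->
    inner (z m - z n) (z m - z n) < 4^-1 ^+ k.
  suff /choice[N NP] : forall k, exists N, forall m n, (N <= m)%N -> (N <= n)%N ->
    inner (z m - z n) (z m - z n) < 4^-1 ^+ k by exists N.
  by move=> k; apply: zC; rewrite exprn_gt0// invr_gt0.
(* Partial sums make the indices nondecreasing and at least [N k]. *)
pose n_ k := (\sum_(i < k.+1) N i)%N.
have Nn k : (N k <= n_ k)%N by rewrite /n_ big_ord_recr leq_addl.
have nS k : (n_ k <= n_ k.+1)%N by rewrite /n_ [leqRHS]big_ord_recr leq_addr.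
have yK k : bounded_by K (z (n_ k)) by exact: zK.
have yC k : inner (z (n_ k.+1) - z (n_ k)) (z (n_ k.+1) - z (n_ k)) <= 4^-1 ^+ k.
  by apply/ltW/NP => //; exact: leq_trans (nS k).
exists (bmf_limsup yK) => e e0.
(* The constant collects 2 * 4^-k and 2 * (4K 2^-k), each power being at most 1/(k+1). *)
have [k /(_ _ (leqnn k)) Hk] := inv_succ_lt (2 + 8 * `|K|) e0.
exists (N k) => n Nkn; set w := bmf_limsup yK.
rewrite -[z n - w](subrKA (z (n_ k))).
have H := sqD_le ip_sym ip_add ip_scale ip_ge0 (z n - z (n_ k)) (z (n_ k) - w).
apply: le_lt_trans H _.
have H1 := NP k n (n_ k) Nkn (Nn k).
have H2 := ip_limsup yK yC k; rewrite -/w in H2.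
have k2 : 2^-1 ^+ k <= k.+1%:R^-1 :> R.
  rewrite exprVn lef_pV2 ?posrE ?ltr0n ?exprn_gt0//.
  by rewrite -natrX ler_nat ltn_expl.
have k4 : 4^-1 ^+ k <= 2^-1 ^+ k :> R.
  by apply: lerXn2r; rewrite ?nnegrE ?invr_ge0//; lra.
have H3 : 4 * K * 2^-1 ^+ k <= 4 * `|K| * k.+1%:R^-1.
  apply: (@le_trans _ _ (4 * `|K| * 2^-1 ^+ k)).
    by rewrite ler_wpM2r ?exprn_ge0 ?invr_ge0// ler_wpM2l// ler_norm.
  by rewrite ler_wpM2l// mulr_ge0.
have {}Hk : 2 * k.+1%:R^-1 + 8 * `|K| * k.+1%:R^-1 < e by rewrite -mulrDl.
move: (k.+1%:R^-1) k2 H3 Hk (`|K|) => q k2 H3 Hk K'.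
lra.
Qed.
End BoundedMeasurable.

(** * Cylinders *)

Section Cube.
Variable M : countType.

Definition cyl (l : seq ((M * M) * bool)) : set (Bcube M) :=
  [set x | all (fun q => x q.1 == q.2) l].

Lemma cyl_cat l1 l2 : cyl (l1 ++ l2) = cyl l1 `&` cyl l2.
Proof.
apply/seteqP; split => x; rewrite /cyl /= all_cat; first by move/andP.
by move=> [? ?]; apply/andP.
Qed.

Lemma cyl_basis (U : set (cube M)) (x : cube M) : open U -> U x ->
  exists l, cyl l x /\ cyl l `<=` U.
Proof.
move=> Uo Ux.
pose F := filter_from [set l | cyl l x] cyl.
have FF : Filter F.
  apply: filter_from_filter; first by exists [::].
  by move=> l1 l2 H1 H2; exists (l1 ++ l2); rewrite ?cyl_cat//=; rewrite cyl_cat.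
have Fx : F --> x.
  (* The product topology is the supremum of the coordinate topologies, so one coordinate can be
     treated at a time. *)
  apply/cvg_sup => p A.
  rewrite (@nbhsE (initial_topology (fun f : M * M -> bool => f p))).
  move=> -[B [[C Co <-] Bx] BA].
  exists [:: (p, x p)]; first by rewrite /cyl /= eqxx.
  move=> y; rewrite /cyl /= andbT => /eqP yp; apply: BA.
  by rewrite /= yp.
have [l lx lU] := Fx U (open_nbhs_nbhs (conj Uo Ux)).
by exists l.
Qed.

Lemma coord_open (p : M * M) b : open ([set x | x p = b] : set (cube M)).
Proof.
have -> : [set x : cube M | x p = b] = proj p @^-1` [set b] by [].
apply: open_comp; last exact: discrete_open.
by move=> x _; exact: proj_continuous.
Qed.

Lemma measurable_coord (p : M * M) : measurable_fun setT (fun x : Bcube M => x p).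
Proof.
apply: (measurable_fun_bool true); rewrite setTI.
by apply: sub_sigma_algebra; exact: coord_open.
Qed.

Lemma measurable_cyl l : measurable (cyl l).
Proof.
elim: l => [|q l IH].
  by rewrite (_ : cyl [::] = setT)//; apply/seteqP; split.
rewrite -cat1s cyl_cat; apply: measurableI => //.
apply: sub_sigma_algebra.
rewrite (_ : cyl [:: q] = [set x | x q.1 = q.2]); first exact: coord_open.
by apply/seteqP; split => x; rewrite /cyl /= andbT => /eqP.
Qed.

Lemma open_bigcup_cyl (U : set (cube M)) : open U ->
  U = \bigcup_(l in [set l | cyl l `<=` U]) cyl l.
Proof.
move=> Uo; apply/seteqP; split => [x Ux|x [l lU]]; last exact: lU.
by have [l [lx lU]] := cyl_basis Uo Ux; exists l.
Qed.

(** As M is countable there are countably many cylinders, and every open set is a countable union of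
    them. *)
Lemma measurable_cubeE :
  (measurable : set (set (Bcube M))) = <<s range cyl >>.
Proof.
apply/seteqP; split.
  apply: smallest_sub; first exact: smallest_sigma_algebra.
  move=> U Uo; rewrite (open_bigcup_cyl Uo).
  rewrite bigcup_mkcond.
  apply: (@countable_bigcupT_measurable _ (g_sigma_algebraType (range cyl))) => //.
  by move=> l; case: ifP => // _; apply: sub_sigma_algebra; exists l.
apply: smallest_sub; first exact: sigma_algebra_measurable.
by move=> _ [l _ <-]; exact: measurable_cyl.
Qed.

Lemma cyl_setI_closed : setI_closed (range cyl).
Proof. by move=> _ _ [l1 _ <-] [l2 _ <-]; exists (l1 ++ l2) => //; rewrite cyl_cat. Qed.

Lemma measure_cyl_unique (R : realType) (mu nu : {measure set (Bcube M) -> \bar R}) :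
  (mu setT < +oo)%E -> (forall l, mu (cyl l) = nu (cyl l)) ->
  forall A, measurable A -> mu A = nu A.
Proof.
move=> mufin H A mA.
have cyl0 : cyl [::] = setT by apply/seteqP; split.
apply: (measure_unique (range cyl) (fun=> setT)) => //.
- exact: measurable_cubeE.
- exact: cyl_setI_closed.
- by move=> _; exists [::].
- by apply/seteqP; split => // x _; exists 0.
- by move=> _ [l _ <-].
Qed.

Lemma measurable_act (g : M -> M) : measurable_fun setT (@act_inv M g).
Proof.
apply: (@measurability _ _ (Bcube M) (Bcube M) setT _ (range cyl)).
  exact: measurable_cubeE.
move=> _ [_ [l _ <-] <-]; rewrite setTI.
rewrite (_ : _ @^-1` _ = cyl [seq ((g q.1.1, g q.1.2), q.2) | q <- l]).
  exact: measurable_cyl.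
by apply/seteqP; split => x; rewrite /cyl /= all_map.
Qed.

Lemma act_inv_comp g h x : @act_inv M h (@act_inv M g x) = act_inv (g \o h) x.
Proof. by []. Qed.

Lemma measurable_LO : measurable (@LO M).
Proof.
(* The three axioms at one triple of points form a single event, and there are countably many
   triples. *)
pose F (q : M * M * M) := ~` ((fun x : Bcube M =>
  [&& ~~ x (q.1.1, q.1.1),
    ~~ (x (q.1.1, q.1.2) && x (q.1.2, q.2)) || x (q.1.1, q.2) &
    (q.1.1 == q.1.2) || (x (q.1.1, q.1.2) || x (q.1.2, q.1.1))]) @^-1` [set true]).
have -> : @LO M = ~` (\bigcup_q F q).
  rewrite setC_bigcup; under eq_bigcapr do rewrite setCK.
  apply/seteqP; split => [x [ir [tr tot]] [[a b] c] _ /=|x H].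
    rewrite ir /=; apply/andP; split.
      by rewrite -implybE; apply/implyP => /andP[]; exact: tr.
    by have [//|/tot] := eqVneq a b.
  split=> [a|]; first by have /and3P[] := H (a, a, a) I.
  split=> [a b c ab bc|a b ab].
    by have /and3P[/= _ + _] := H (a, b, c) I; rewrite ab bc.
  by have /and3P[/= _ _] := H (a, b, a) I; rewrite (negPf ab).
apply/measurableC/countable_bigcupT_measurable => // -[[a b] c].
apply: measurableC; rewrite -[X in measurable X]setTI.
by do !(apply: measurable_and || apply: measurable_or || apply: measurable_neg
  || exact: measurable_coord || exact: measurable_cst).
Qed.
End Cube.

Lemma ae_forall_count d (T : measurableType d) (R : realType)
    (mu : {measure set T -> \bar R}) (I : countType) (P : I -> T -> Prop) :
  (forall i, {ae mu, forall x, P i x}) -> {ae mu, forall x, forall i, P i x}.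
Proof.
move=> H.
have /ae_foralln : forall n, {ae mu, forall x,
    if unpickle n is Some i then P i x else True}.
  by move=> n; case: (unpickle n) => [i|]; [exact: H|exact: aeW].
by apply: filterS => x Hx i; have := Hx (pickle i); rewrite pickleK.
Qed.

Lemma bmf_mulE d (T : measurableType d) (R : realType) (f g : bmf T R) x :
  bmf_mul f g x = f x * g x.
Proof. by []. Qed.

(** * Invariant measures *)

Section InvariantMeasure.
Variables (M : countType) (G : set (M -> M)).
Hypotheses (G1 : G id) (GM : forall g h, G g -> G h -> G (g \o h)).
Hypothesis GV : forall g, G g -> exists h, [/\ G h, g \o h = id & h \o g = id].
Hypotheses (M0 : exists m : M, True) (oligo : finitely_many_orbits G).
Hypotheses (noalg : no_algebraicity G) (wei : weak_EI G).
Hypothesis trans : transitive_action G.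
Variables (R : realType) (nu : probability (Bcube M) R).
Hypotheses (nuLO : on_LO nu) (nuG : G_invariant G nu).

Local Notation V := (bmf (Bcube M) R).
Local Notation E := (Ex nu).
Local Notation ip := (inner nu).

Lemma nu_setC_LO : nu (~` @LO M) = 0%E.
Proof.
rewrite (probability_setC nu (@measurable_LO M)).
by have -> : nu (@LO M) = 1%E := nuLO; rewrite subee.
Qed.

Lemma ae_LO : {ae nu, forall x, LO x}.
Proof.
exists (~` @LO M); split => //; last exact: nu_setC_LO.
exact: (measurableC (@measurable_LO M)).
Qed.

(** Invariance is assumed for Borel subsets of LO(M) only. It extends because the complement of
    LO(M) and its preimage are both null. *)
Lemma nu_act g A : G g -> measurable A -> nu (@act_inv M g @^-1` A) = nu A.
Proof.
move=> Gg mA; have mLO := @measurable_LO M.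
have mpre B : measurable B -> measurable (@act_inv M g @^-1` B).
  by move=> mB; rewrite -[X in measurable X]setTI; exact: measurable_act.
have LO0 := nu_setC_LO.
have gLO0 : nu (@act_inv M g @^-1` (~` @LO M)) = 0%E.
  rewrite -preimage_setC (probability_setC nu (mpre _ mLO)).
  rewrite (nuG Gg mLO (fun x Lx => Lx)).
  by have -> : nu (@LO M) = 1%E := nuLO; rewrite subee.
have split_LO B : measurable B -> nu B = (nu (B `&` @LO M) + nu (B `\` @LO M))%E.
  by move=> mB; rewrite addeC -measureDI.
have small B C : measurable B -> measurable C -> B `<=` C -> nu C = 0%E -> nu B = 0%E.
  move=> mB mC BC C0; apply/eqP; rewrite eq_le measure_ge0 andbT -C0.
  by apply: le_measure => //; rewrite inE.
have -> : nu A = nu (A `&` @LO M).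
  rewrite split_LO// (small _ _ (measurableD mA mLO) (measurableC mLO) _ LO0).
    by rewrite adde0.
  by move=> x [].
have mI : measurable (A `&` @LO M) by exact: measurableI.
have mD : measurable (A `\` @LO M) by exact: measurableD.
rewrite -(nuG Gg mI (@subIsetr _ _ _)) -{1}(setUIDK A (@LO M)) preimage_setU.
rewrite measureU; last 3 first.
- exact: mpre.
- exact: mpre.
- by apply/seteqP; split => // x [[_ Lx] [_]]; apply.
rewrite [X in (_ + X)%E](small _ _ (mpre _ mD) (mpre _ (measurableC mLO)) _ gLO0) ?adde0//.
by move=> x [_ nLx].
Qed.

Lemma ae_act g (Q : Bcube M -> Prop) : G g -> {ae nu, forall x, Q x} ->
  {ae nu, forall x, Q (act_inv g x)}.
Proof.
move=> Gg [N [mN N0 QN]]; exists (@act_inv M g @^-1` N); split.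
- by rewrite -[X in measurable X]setTI; exact: measurable_act.
- by rewrite nu_act.
- by move=> x /= H; apply: QN.
Qed.

(** The map [act_inv g] is the action of the inverse of g on orders, so precomposition yields a left
    action on functions. *)
Definition act g (f : V) : V := bmf_comp f (measurable_act g).

Lemma act_lin g : linear (act g).
Proof. by move=> a u v; apply: val_inj. Qed.
Lemma act1 v : act id v = v.
Proof. by apply: val_inj; apply/funext => x /=; congr (v _); apply/funext => -[]. Qed.
Lemma actM g h v : act (g \o h) v = act g (act h v).
Proof. by apply: val_inj. Qed.

Lemma E_act g v : G g -> E (act g v) = E v.
Proof.
move=> Gg; rewrite /Ex /Rintegral; congr fine.
have mf : measurable_fun setT (EFin \o v).
  by apply/measurable_EFinP; exact: bmf_measurable.
have vi := bmf_integrable nu (act g v).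
have <- : (\int[pushforward nu (act_inv g)]_x (v x)%:E =
    \int[nu]_x (v (act_inv g x))%:E)%E.
  by rewrite (integral_pushforward (measurable_act g)).
apply: eq_measure_integral; first exact: measurable_act.
by move=> mg A mA _; exact: nu_act.
Qed.

Lemma ip_act g u v : G g -> ip (act g u) (act g v) = ip u v.
Proof. by move=> Gg; rewrite /inner -(E_act (bmf_mul u v) Gg). Qed.

Lemma null_ae (u : V) : ip u u = 0 <-> {ae nu, forall x, u x = 0}.
Proof.
split; first exact: ip_eq0.
move=> u0; rewrite -(Ex_cst nu 0); apply: (@Ex_ae _ _ _ nu (bmf_mul u u) (bmf_cst _ 0)).
by apply: filterS u0 => x /= ->; rewrite mulr0.
Qed.

Definition ae_fixed A (f : V) := forall g, stab G A g ->
  {ae nu, forall x, f (act_inv g x) = f x}.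

Lemma fixed_ae_fixed A f : fixed G ip act A f <-> ae_fixed A f.
Proof.
split => Af g /Af.
  by move/null_ae; apply: filterS => x /eqP; rewrite bmfBE subr_eq0 => /eqP.
move=> H; apply/null_ae; apply: filterS H => x H.
by rewrite bmfBE [act g f x]/= H subrr.
Qed.

Lemma ae_fixed_proj A B u : ae_fixed A u -> exists w, ae_fixed [seq x <- A | x \in B] w /\
  forall Y, ae_fixed B Y -> ip w Y = ip u Y.
Proof.
move=> /fixed_ae_fixed Au.
have [||w [/fixed_ae_fixed wA wY]] := @proj_commute _ _ G1 GM GV M0 oligo noalg wei
  R (V : lmodType R) ip act (@bounded_by _ _ R) (@ip_sym _ _ _ nu) (@ip_add _ _ _ nu)
  (@ip_scale _ _ _ nu) (@ip_ge0 _ _ _ nu) act_lin act1 actM ip_act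
  _ _ (@bounded_by_mean _ _ R) (@ip_complete _ _ R nu) A B u Au.
- exact: bmf_bounded.
- by move=> K g v vK x; exact: vK.
exists w; split => // Y /fixed_ae_fixed; exact: wY.
Qed.

Lemma ae_fixedS A B f : {subset A <= B} -> ae_fixed A f -> ae_fixed B f.
Proof. by move=> AB Af g /(stab_sub AB)/Af. Qed.

Lemma ae_fixed_act A g f : G g -> ae_fixed A f -> ae_fixed (map g A) (act g f).
Proof.
move=> Gg Af h gAh; have [k [Gk gk kg]] := GV Gg.
have := ae_act Gg (Af _ (stab_conj GM Gg Gk kg gAh)); apply: filterS => x.
rewrite /= !act_inv_comp => <-; congr (f (act_inv _ x)).
by apply/funext => y /=; exact/esym/(congr1 (@^~ (h (g y))) gk).
Qed.

Lemma ae_fixedB A u v : ae_fixed A u -> ae_fixed A v -> ae_fixed A (u - v).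
Proof.
move=> Au Av g Ag; apply: filterS2 (Au g Ag) (Av g Ag) => x.
by rewrite !bmfBE => -> ->.
Qed.

Lemma ip_subl u v w : ip (u - v) w = ip u w - ip v w.
Proof. by rewrite ip_add -scaleN1r ip_scale mulN1r. Qed.

Lemma ae_fixed_eq A u v : ae_fixed A u -> ae_fixed A v ->
  (forall Y, ae_fixed A Y -> ip u Y = ip v Y) -> {ae nu, forall x, u x = v x}.
Proof.
move=> Au Av uv; have := ae_fixedB Au Av => /uv H.
have /null_ae : ip (u - v) (u - v) = 0 by rewrite ip_subl H subrr.
by apply: filterS => x; rewrite bmfBE => /eqP; rewrite subr_eq0 => /eqP.
Qed.

Lemma ip_ae (u v w : V) : {ae nu, forall x, u x = v x} -> ip u w = ip v w.
Proof.
move=> uv; apply: (@Ex_ae _ _ _ nu (bmf_mul u w) (bmf_mul v w)).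
by apply: filterS uv => x /= ->.
Qed.

Lemma ip_act_inv g h u v : G g -> G h -> h \o g = id ->
  ip (act g u) v = ip u (act h v).
Proof. by move=> Gg Gh hg; rewrite -(ip_act _ _ Gh) -actM hg act1. Qed.

Definition lt_fun (a b : M) : V := bmf_test R (measurable_coord (a, b)).

Lemma ae_fixed_lt a b : ae_fixed [:: a; b] (lt_fun a b).
Proof.
move=> g [_ gab]; apply: aeW => x /=.
by rewrite /act_inv /= !gab ?inE ?eqxx ?orbT.
Qed.

(** The tuples (a, b) and (a, B) share only [a], so the projection of 1[a < b] on H_(a, B) already
    lies in H_a. It therefore agrees with [f] almost everywhere, whatever B is. *)
Lemma order_proj_exists a b : a != b -> exists f, ae_fixed [:: a] f /\
  forall B Y, b \notin B -> ae_fixed B Y -> ip f Y = ip (lt_fun a b) Y.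
Proof.
move=> ab; have [f [fa fP]] := ae_fixed_proj [:: a] (@ae_fixed_lt a b).
rewrite /= !inE eqxx eq_sym (negPf ab) in fa.
exists f; split => // B Y bB BY.
have [w [wa wP]] := ae_fixed_proj (a :: B) (@ae_fixed_lt a b).
rewrite /= !inE eqxx eq_sym (negPf ab) (negPf bB) in wa.
have aBY : ae_fixed (a :: B) Y by apply: ae_fixedS BY => z zB; rewrite inE zB orbT.
rewrite -wP//; apply: ip_ae; apply: ae_fixed_eq fa wa _ => Z aZ.
rewrite fP// wP//; apply: ae_fixedS aZ => z; rewrite !inE => /eqP ->.
by rewrite eqxx.
Qed.

(** * Projections of the events a < b on the functions fixed by G_a *)

Section Cond.
Variable f : M -> M -> V.
Hypothesis f_inv : forall a b, a != b -> ae_fixed [:: a] (f a b).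
Hypothesis fP : forall a b, a != b -> forall B Y, b \notin B -> ae_fixed B Y ->
  ip (f a b) Y = ip (lt_fun a b) Y.

Lemma act_lt g a b : act g (lt_fun a b) = lt_fun (g a) (g b).
Proof. by apply: val_inj. Qed.

(** A projection is determined almost everywhere by its inner products, so G permutes these
    functions as it permutes the pairs (a, b). *)
Lemma f_act g a b : G g -> a != b ->
  {ae nu, forall x, f a b (act_inv g x) = f (g a) (g b) x}.
Proof.
move=> Gg ab; have gi := G_inj GV Gg.
have gab : g a != g b by rewrite (inj_eq gi).
apply: (@ae_fixed_eq [:: g a] (act g (f a b))).
- exact: (ae_fixed_act Gg (f_inv ab)).
- exact: f_inv.
move=> Y Yg; have [h [Gh gh hg]] := GV Gg.
have hY : ae_fixed [:: a] (act h Y).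
  have := ae_fixed_act Gh Yg; rewrite /=.
  by have /= -> := congr1 (@^~ a) hg.
rewrite (ip_act_inv _ _ Gg Gh hg) (fP ab _ hY) ?inE 1?eq_sym//.
rewrite -(ip_act_inv _ _ Gg Gh hg) act_lt (fP gab _ Yg)// inE eq_sym//.
Qed.

Lemma f_orbit a b b' g : a != b -> stab G [:: a] g -> g b = b' ->
  {ae nu, forall x, f a b x = f a b' x}.
Proof.
move=> ab ag gb; have [Gg /(_ a (mem_head _ _)) ga] := ag.
have := f_act Gg ab; rewrite ga gb => H.
by apply: filterS2 H (f_inv ab ag) => x <- ->.
Qed.

Lemma Ex_le_ae (u v : V) : {ae nu, forall x, u x <= v x} -> E u <= E v.
Proof.
move=> uv.
have mt : measurable_fun setT (fun x => u x <= v x).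
  by apply: measurable_fun_ler; exact: bmf_measurable.
have key w : E (bmf_mul w (bmf_test R mt)) = E w.
  apply: (@Ex_ae _ _ _ nu (bmf_mul w (bmf_test R mt)) w).
  by apply: filterS uv => x /= ->; rewrite mulr1.
rewrite -(key u) -(key v); apply: Ex_le => x /=.
by case: (boolP (u x <= v x)) => [H|_]; rewrite ?mulr1 ?mulr0.
Qed.

(* On LO, a < c and c < b imply a < b; project this on the functions fixed by the
   stabiliser of a and c. *)
Lemma f_mono a b c : a != b -> c != b -> a != c ->
  {ae nu, forall x : Bcube M, x (a, c) -> f c b x <= f a b x}.
Proof.
move=> ab cb ac.
(* [Y] is the indicator of the event where the claim fails. The integral of (f_cb - f_ab) Y is
   nonnegative by choice of [Y] and nonpositive by transitivity of the order. *)
have mt : measurable_fun setT (fun x : Bcube M => x (a, c) && (f a b x < f c b x)).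
  apply: measurable_and; first exact: measurable_coord.
  by apply: measurable_fun_ltr; exact: bmf_measurable.
pose Y := bmf_test R mt.
have Yac : ae_fixed [:: a; c] Y.
  move=> g acg; have [Gg H] := acg.
  have ga : g a = a by rewrite H ?inE ?eqxx.
  have gc : g c = c by rewrite H ?inE ?eqxx ?orbT.
  have ag : stab G [:: a] g by split => // z; rewrite inE => /eqP ->.
  have cg : stab G [:: c] g by split => // z; rewrite inE => /eqP ->.
  apply: filterS2 (f_inv ab ag) (f_inv cb cg) => x fa fc /=.
  by rewrite fa fc /act_inv /= ga gc.
have bac : b \notin [:: a; c] by rewrite !inE negb_or eq_sym ab eq_sym cb.
have le0 : ip (f c b - f a b) Y <= 0.
  rewrite ip_subl (fP cb bac Yac) (fP ab bac Yac) -ip_subl -(Ex_cst nu 0).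
  apply: (@Ex_le_ae (bmf_mul (lt_fun c b - lt_fun a b) Y) (bmf_cst _ 0)).
  apply: filterS ae_LO => x [_ [tr _]].
  rewrite bmf_mulE bmfBE /=.
  case: (boolP (x (a, c))) => [xac|]; last by rewrite /= mulr0.
  case: (boolP (x (c, b))) => [xcb|_].
    by rewrite (tr _ _ _ xac xcb) subrr mul0r.
  by rewrite sub0r mulNr oppr_le0 mulr_ge0// ler0n.
have ge0 x : 0 <= bmf_mul (f c b - f a b) Y x.
  rewrite bmf_mulE bmfBE /=; case: (x (a, c)); rewrite ?mulr0//=.
  by case: ltP => H; rewrite ?mulr0// mulr1 subr_ge0 ltW.
have : E (bmf_mul (f c b - f a b) Y) = 0.
  by apply/eqP; rewrite eq_le; apply/andP; split => //; exact: Ex_ge0.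
move=> /(Ex_eq0 ge0); apply: filterS => x + xac.
rewrite bmf_mulE bmfBE /= xac /=; case: (ltP (f a b x) (f c b x)) => // H.
by rewrite mulr1 => /eqP; rewrite subr_eq0 => /eqP H'; rewrite H' ltxx in H.
Qed.

(* All translates of Y have the same projection w on the invariant functions, and
   translates based at distinct points are independent conditionally on those. *)
Lemma correlation m Y h h' : ae_fixed [:: m] Y -> G h -> G h' -> h m != h' m ->
  E Y ^+ 2 <= ip (act h Y) (act h' Y).
Proof.
move=> mY Gh Gh' hm.
have hY := ae_fixed_act Gh mY; have h'Y := ae_fixed_act Gh' mY.
have [w [w0 wP]] := ae_fixed_proj [:: h' m] hY.
rewrite /= inE (negPf hm) in w0.
have w_act g Z : G g -> ip w (act g Z) = ip w Z.
  move=> Gg; have [k [Gk gk kg]] := GV Gg.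
  rewrite ip_sym (ip_act_inv _ _ Gg Gk kg) ip_sym; apply: ip_ae.
  by apply: w0; split.
have inv0 B Z : ae_fixed [::] Z -> ae_fixed B Z by apply: ae_fixedS.
have ww : ip w w = ip (act h Y) (act h' Y).
  rewrite (wP w)//; last exact: inv0.
  by rewrite ip_sym -(wP _ h'Y) !w_act.
have w1 : ip w (bmf_cst _ 1) = E Y.
  rewrite wP; last by move=> g _; apply: aeW.
  rewrite -(E_act Y Gh); apply: (@Ex_ae _ _ _ nu (bmf_mul _ _)).
  by apply: aeW => x /=; rewrite mulr1.
have := cauchy_schwarz (@ip_sym _ _ _ nu) (@ip_add _ _ _ nu) (@ip_scale _ _ _ nu)
  (@ip_ge0 _ _ _ nu) w (bmf_cst _ 1).
rewrite w1 ww.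
have -> : ip (bmf_cst _ 1) (bmf_cst _ 1) = 1.
  rewrite -[RHS](Ex_cst nu 1); apply: (@Ex_ae _ _ _ nu (bmf_mul _ _) (bmf_cst _ _)).
  by apply: aeW => x /=; rewrite mulr1.
by rewrite mulr1.
Qed.

(** * An invariant order from a dependence of f_ab on b *)

Section Dichotomy.
Variables m0 b1 b2 : M.
Hypotheses (mb1 : m0 != b1) (mb2 : m0 != b2).
Hypothesis f_neq : ~ {ae nu, forall x, f m0 b1 x = f m0 b2 x}.

(** A constraint (b, q, e) bounds [f m0 b] below by q if e is true and above otherwise. Rational
    bounds keep the boxes countable, so almost every x avoids all null boxes at once. *)
Definition sat (x : Bcube M) (c : M * rat * bool) : bool :=
  if c.2 then ratr c.1.2 < f m0 c.1.1 x else f m0 c.1.1 x < ratr c.1.2.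

Definition box l x := all (sat x) l.

Lemma measurable_sat c : measurable_fun setT (sat^~ c).
Proof.
case: c => [[b q] [|]]; rewrite /sat /=.
  by apply: measurable_fun_ltr; [exact: measurable_cst|exact: bmf_measurable].
by apply: measurable_fun_ltr; [exact: bmf_measurable|exact: measurable_cst].
Qed.

Lemma measurable_box l : measurable_fun setT (box l).
Proof.
elim: l => [|c l IH]; first exact: measurable_cst.
by apply: measurable_and => //; exact: measurable_sat.
Qed.

Definition box_fun l : V := bmf_test R (measurable_box l).

Lemma ae_fixed_box l : all (fun c => m0 != c.1.1) l -> ae_fixed [:: m0] (box_fun l).
Proof.
move=> lm g mg.
suff : {ae nu, forall x, box l (act_inv g x) = box l x}.
  by apply: filterS => x /= ->.
elim: l lm => [_|c l IH /= /andP[cm lm]]; first exact: aeW.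
apply: filterS2 (f_inv cm mg) (IH lm) => x fx lx.
by rewrite /box /= -/(box l _) lx /sat fx.
Qed.

(** The last two properties are countable families of almost sure conditions. Were the first to fail
    wherever they hold, it would fail almost surely, against [f_neq]. *)
Lemma generic_point : exists x0 : Bcube M, [/\ f m0 b1 x0 != f m0 b2 x0,
  forall l, box l x0 -> 0 < E (box_fun l) &
  forall b g, m0 != b -> stab G [:: m0] g -> f m0 (g b) x0 = f m0 b x0].
Proof.
have A1 : {ae nu, forall x, forall l, box l x -> 0 < E (box_fun l)}.
  apply: ae_forall_count => l.
  have [E0|E0] := eqVneq (E (box_fun l)) 0; last first.
    apply: aeW => x _; rewrite lt_neqAle eq_sym E0.
    by apply: Ex_ge0 => y /=; exact: ler0n.
  have := @Ex_eq0 _ _ _ nu (box_fun l) (fun x => ler0n _ _) E0.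
  apply: filterS => x /=; case: (box l x) => // /eqP.
  by rewrite oner_eq0.
have A2 : {ae nu, forall x, forall bb : M * M, m0 != bb.1 ->
    (exists2 g, stab G [:: m0] g & g bb.1 = bb.2) -> f m0 bb.2 x = f m0 bb.1 x}.
  apply: ae_forall_count => -[b b'] /=.
  have [mb|nmb] := boolP (m0 != b); last by apply: aeW => x.
  have [[g mg gb]|ng] := pselect (exists2 g, stab G [:: m0] g & g b = b');
    last by apply: aeW => x _ /ng.
  by have := f_orbit mb mg gb; apply: filterS => x ->.
apply: contrapT => /forallNP nx; apply: f_neq.
apply: filterS2 A1 A2 => x H1 H2; apply/eqP/negPn/negP => H.
apply: (nx x); split => // b g mb mg.
by apply: (H2 (b, g b)) => //; exists g.
Qed.

Lemma invariant_order : exists x, LO x /\ fixed_point G x.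
Proof.
have [x0 [x0b x0box x0orb]] := generic_point.
have [k kP] : exists k : M -> M -> M, forall a, G (k a) /\ k a a = m0.
  suff /choice[k H] : forall a, exists k, G k /\ k a = m0 by exists k.
  by move=> a; have [g Gg ga] := trans a m0; exists g.
have [h hP] : exists h : M -> M -> M, forall a, [/\ G (h a), k a \o h a = id,
    h a \o k a = id & h a m0 = a].
  suff /choice[h H] : forall a, exists h, [/\ G h, k a \o h = id,
    h \o k a = id & h m0 = a] by exists h.
  move=> a; have [Gk ka] := kP a; have [h [Gh kh hk]] := GV Gk.
  by exists h; split => //; rewrite -ka; exact: (congr1 (@^~ a) hk).
have k_inj a : injective (k a) by apply: (G_inj GV); have [] := kP a.
have kne a b : a != b -> m0 != k a b.
  by move=> ab; have [_ <-] := kP a; rewrite (inj_eq (@k_inj a)).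
(* The pair (a, b) is moved to the base point [m0]. The result does not depend on the choice of
   [k a], because values at x0 are constant on G_m0-orbits. *)
pose t a b := f m0 (k a b) x0.
have tG g a b : G g -> a != b -> t (g a) (g b) = t a b.
  move=> Gg ab; rewrite /t.
  have [Gh kh hk ha] := hP a; have [Gk ka] := kP (g a).
  have mg : stab G [:: m0] (k (g a) \o (g \o h a)).
    split; first by apply: (GM Gk); exact: GM.
    by move=> z; rewrite inE => /eqP ->; rewrite /= ha ka.
  rewrite -(x0orb _ _ (kne _ _ ab) mg) /=.
  by have /= -> := congr1 (@^~ b) hk.
(* The translates to a and to c of a small box around the values at x0 intersect;
   there the order of a and c orders f a _ and f c _ at b and at b' alike. *)
have dom a b b' c : a != b -> a != b' -> c != b -> c != b' -> a != c ->
    t c b < t a b -> t c b' <= t a b'.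
  move=> ab ab' cb cb' ac /rat_in_itvoo[q1]; rewrite in_itv /= => /andP[q1c q1a].
  rewrite leNgt; apply/negP => /rat_in_itvoo[q2]; rewrite in_itv /= => /andP[q2a q2c].
  (* All four constraints sit in one box since [correlation] compares two translates of the same
     function. The translate to a uses the first two, the translate to c the last two. *)
  pose l := [:: (k a b, q1, true); (k a b', q2, false);
                (k c b, q1, false); (k c b', q2, true)].
  have l0 : box l x0 by rewrite /box /= /sat /= q1c q1a q2a q2c.
  have lm : all (fun c => m0 != c.1.1) l by rewrite /= !kne.
  have [Gha kha hka ha] := hP a; have [Ghc khc hkc hc] := hP c.
  have := correlation (ae_fixed_box lm) Gha Ghc; rewrite ha hc => /(_ ac).
  apply/negP; rewrite -ltNge.
  have -> : ip (act (h a) (box_fun l)) (act (h c) (box_fun l)) = 0; last first.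
    by rewrite exprn_gt0// x0box.
  rewrite -(Ex_cst nu 0); apply: (@Ex_ae _ _ _ nu (bmf_mul _ _) (bmf_cst _ 0)).
  have fh e d : e != d -> {ae nu, forall x,
      f m0 (k e d) (act_inv (h e) x) = f e d x}.
    move=> ed; have [Ghe khe hke he] := hP e.
    have := f_act Ghe (kne _ _ ed); rewrite he.
    by have /= -> := congr1 (@^~ d) hke.
  have m1 := f_mono ab' cb' ac; have m2 := f_mono cb ab; rewrite eq_sym in m2.
  have {}m2 := m2 ac.
  apply: (filterS _ (filterI (filterI (filterI (fh _ _ ab) (fh _ _ ab'))
    (filterI (fh _ _ cb) (fh _ _ cb'))) (filterI (filterI m1 m2) ae_LO))).
  move=> x [[[X4 X5] [X6 X7]] [[X1 X2] [_ [_ X3]]]].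
  have boxE e : act (h e) (box_fun l) x = (box l (act_inv (h e) x))%:R by [].
  rewrite bmf_mulE !boxE.
  case B1: (box l (act_inv (h a) x)); last by rewrite mul0r.
  case B2: (box l (act_inv (h c) x)); last by rewrite mulr0.
  exfalso; move: B1 B2; rewrite /box /= /sat /= X4 X5 X6 X7.
  move=> /and5P[Y1 Y2 _ _ _] /and5P[_ _ Y3 Y4 _].
  case/orP: (X3 _ _ ac) => [/X1|/X2] H.
    by have := lt_trans Y2 Y4; rewrite ltNge H.
  by have := lt_trans Y3 Y1; rewrite ltNge H.
(* The G_(a, c)-orbit of b is infinite, so a witness b for comparing a and c can be moved off any
   finite set, such as a third point to be compared. *)
have twin a b c (L : seq M) : b != a -> b != c -> exists b', [/\ b' \notin L, b' != a, b' != c,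
    t a b' = t a b & t c b' = t c b].
  move=> ba bc; have [|g [Gg gac] gL] := @no_alg_avoid _ _ noalg [:: a; c] L b.
    by rewrite !inE negb_or ba.
  have ga : g a = a by rewrite gac ?inE ?eqxx.
  have gc : g c = c by rewrite gac ?inE ?eqxx ?orbT.
  have gi := G_inj GV Gg.
  exists (g b); split => //.
  - by rewrite -[X in _ != X]ga (inj_eq gi).
  - by rewrite -[X in _ != X]gc (inj_eq gi).
  - by rewrite -{1}ga tG// eq_sym.
  - by rewrite -{1}gc tG// eq_sym.
pose r a c := a != c /\ exists b, [/\ a != b, c != b & t c b < t a b].
pose tie a c := a = c \/ forall b, a != b -> c != b -> t a b = t c b.
have rdom a c b : r a c -> a != b -> c != b -> t c b <= t a b.
  by move=> [ac [b' [ab' cb' H]]] ab cb; exact: dom H.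
have rtrans a c d : r a c -> r c d -> r a d.
  move=> rac rcd; have [ac [b [ab cb tb]]] := rac.
  have [ad|ad] := eqVneq a d.
    by have := rdom _ _ b rcd cb; rewrite -ad ab leNgt tb => /(_ isT).
  split=> //; rewrite eq_sym in ab; rewrite eq_sym in cb.
  have [b' [b'd b'a b'c ta tc]] := twin a b c [:: d] ab cb.
  rewrite inE in b'd; exists b'; split; rewrite 1?eq_sym//.
  rewrite ta; apply: le_lt_trans tb; rewrite -tc.
  by apply: rdom rcd _ _; rewrite eq_sym.
have rirr a : ~ r a a by move=> [/eqP].
(* By primitivity one tie between distinct points would tie all points. Then t would not depend on
   its first argument, and an element of G taking b1 to b2 would give equal values at b1 and b2,
   against the choice of x0. *)
have tie_all : ~ exists a c, a != c /\ tie a c.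
  move=> [a [c [/eqP ac tac]]].
  have all_tie : forall x y, tie x y.
    apply: (primitive G1 GM GV noalg wei trans (e := tie) _ _ _ _ ac tac).
    - by move=> x; left.
    - by move=> x y [->|H]; [left|right => b yb xb; rewrite H].
    - move=> x y z [->//|xy] [<-|yz]; first by right.
      have [->|xz] := eqVneq x z; [by left|right => b xb zb].
      have [||b' [b'y b'x b'z <- <-]] := twin x b z [:: y]; try by rewrite eq_sym.
      rewrite inE in b'y.
      by rewrite xy ?yz// eq_sym.
    - move=> g x y Gg [->|xy]; first by left.
      have [g' [Gg' gg' g'g]] := GV Gg; right => b.
      have /= <- := congr1 (@^~ b) gg'.
      rewrite !(inj_eq (G_inj GV Gg)) => xb yb.
      by rewrite !tG// xy.
  have tm b : m0 != b -> t m0 b = f m0 b x0.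
    move=> mb; have [Gk km] := kP m0; rewrite /t x0orb//.
    by split => // z; rewrite inE => /eqP ->.
  have [g Gg gb] := trans b1 b2; have gi := G_inj GV Gg.
  have gm : g m0 != b2 by rewrite -gb (inj_eq gi).
  have : t m0 b1 = t m0 b2.
    rewrite -(tG g)// gb; case: (all_tie (g m0) m0) => [->//|]; exact.
  by rewrite !tm// => /eqP; apply/negP.
have rtot a c : a != c -> r a c \/ r c a.
  move=> ac; apply: contrapT => /not_orP[nac nca]; apply: tie_all.
  exists a, c; split => //; right => b ab cb.
  apply/eqP; rewrite eq_le; apply/andP; split; rewrite leNgt; apply/negP => H.
    by apply: nac; split => //; exists b.
  by apply: nca; split; [rewrite eq_sym|exists b].
exists (fun p => `[< r p.1 p.2 >]); split.
  split=> [a|]; first by apply/asboolPn/rirr.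
  split=> [a b c /asboolP ab /asboolP bc|a b /rtot[]H].
  - by apply/asboolP; exact: rtrans bc.
  - by apply/orP; left; apply/asboolP.
  - by apply/orP; right; apply/asboolP.
move=> g Gg; apply/funext => -[a c]; rewrite /act_inv /=.
have rG g' u v : G g' -> r u v -> r (g' u) (g' v).
  move=> Gg'; have gi := G_inj GV Gg'; move=> [uv [b [ub vb H]]].
  split; first by rewrite (inj_eq gi).
  by exists (g' b); rewrite !(inj_eq gi) !tG.
apply: asbool_equiv_eq; split; last exact: rG.
have [g' [Gg' gg' g'g]] := GV Gg => /(rG _ _ _ Gg').
by have /= -> := congr1 (@^~ a) g'g; have /= -> := congr1 (@^~ c) g'g.
Qed.
End Dichotomy.
End Cond.

Hypothesis no_order : ~ exists x, LO x /\ fixed_point G x.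

(** Without an invariant order the projections for c and c' agree almost everywhere, and each
    represents its event against H_B. The point [a] may belong to [B], as it does in the application
    to chains. *)
Lemma exchange a c c' B Y : a != c -> a != c' -> c \notin B -> c' \notin B ->
  ae_fixed B Y -> ip (lt_fun a c) Y = ip (lt_fun a c') Y.
Proof.
move=> ac ac' cB c'B BY.
have [f fP] : exists f : M -> M -> V, forall a b, a != b -> ae_fixed [:: a] (f a b) /\
    forall B Y, b \notin B -> ae_fixed B Y -> ip (f a b) Y = ip (lt_fun a b) Y.
  have H (ab : M * M) : exists f, ab.1 != ab.2 -> ae_fixed [:: ab.1] f /\
      forall B Y, ab.2 \notin B -> ae_fixed B Y -> ip f Y = ip (lt_fun ab.1 ab.2) Y.
    have [e|ne] := eqVneq ab.1 ab.2; first by exists 0.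
    by have [f fP] := order_proj_exists ne; exists f.
  have [f fP] := choice H.
  by exists (fun a b => f (a, b)) => a0 b0; exact: (fP (a0, b0)).
have f_inv a0 b0 (ab : a0 != b0) := (fP a0 b0 ab).1.
have fip a0 b0 (ab : a0 != b0) := (fP a0 b0 ab).2.
rewrite -(fip _ _ ac B)// -(fip _ _ ac' B)//; apply: ip_ae.
apply: contrapT => neq; apply: no_order.
exact: (invariant_order f_inv fip ac ac' neq).
Qed.
End InvariantMeasure.

(** Reduces the disjointness conditions on rearranged lists to linear arithmetic on
    multiplicities. *)
Lemma uniq_count_le (T : eqType) (s1 s2 : seq T) :
  (forall x, (count_mem x s1 <= count_mem x s2)%N) -> uniq s2 -> uniq s1.
Proof.
move=> le us2; apply: count_mem_uniq => x.
have := le x; rewrite (count_uniq_mem x us2) -[x \in s1]has_pred1 has_count.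
by case: (x \in s2); case: (count_mem x s1) => [|[]].
Qed.

(** * Counting chains *)

(* v s U stands for the probability that s is a chain lying below all of U. *)
Section ChainCount.
Variables (M : eqType) (R : realFieldType) (v : seq M -> seq M -> R).
Hypotheses (fresh : forall L : seq M, exists b, b \notin L)
  (v_nil : forall U, v [::] U = 1)
  (v_rec : forall s c U, uniq (c :: U ++ s) ->
    v s (c :: U) = \sum_(d <- c :: U) v (rcons s d) (rem d (c :: U)))
  (v_swap : forall s a c c' U, uniq (c :: U ++ rcons s a) ->
    uniq (c' :: U ++ rcons s a) -> v (rcons s a) (c :: U) = v (rcons s a) (c' :: U))
  (v_perm : forall s U U', perm_eq U U' -> v s U = v s U').

Lemma fresh_seq (L : seq M) n : uniq L ->
  exists W : seq M, size W = n /\ uniq (W ++ L).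
Proof.
move=> uL; elim: n => [|n [W [Wn WL]]]; first by exists [::].
have [b bWL] := fresh (W ++ L).
by exists (b :: W); rewrite /= Wn bWL.
Qed.

(** Points are exchanged one at a time; [r] collects the new ones. *)
Lemma v_replace s a U W r : size U = size W ->
  uniq (U ++ W ++ r ++ rcons s a) -> v (rcons s a) (U ++ r) = v (rcons s a) (W ++ r).
Proof.
elim: U W r => [|c U IH] [|w W] r // [sU] uUW.
have perm1 (x : M) A : perm_eq (A ++ x :: r) (x :: A ++ r).
  by rewrite -cat1s perm_catCA.
rewrite /= (@v_swap s a c w).
- rewrite -(v_perm _ (perm1 w U)) -(v_perm _ (perm1 w W)); apply: IH => //.
  apply: uniq_count_le uUW => x.
  by rewrite /= ?(count_cat, =^~ cats1) /= ?(count_cat, =^~ cats1) /=; lia.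
- apply: uniq_count_le uUW => x.
  by rewrite /= ?(count_cat, =^~ cats1) /= ?(count_cat, =^~ cats1) /=; lia.
- apply: uniq_count_le uUW => x.
  by rewrite /= ?(count_cat, =^~ cats1) /= ?(count_cat, =^~ cats1) /=; lia.
Qed.

(** Replacing the upper set by a fixed fresh [W'] makes each summand of [v_rec] a function [z d] of
    d alone. The sums over d :: W and a :: W, with W fresh, both equal K, so z d = z a; the m+1
    summands over a :: U are equal. *)
Lemma chain_count s U : uniq (U ++ s) ->
  v s U = (size U)`!%:R / (size s + size U)`!%:R.
Proof.
elim/last_ind: s U => [|s a IH] U uUs.
  by rewrite v_nil add0n divff// pnatr_eq0 -lt0n fact_gt0.
pose m := size U.
have [W [Wm uW]] := @fresh_seq (U ++ rcons s a) m uUs.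
have [W' [Wm' uW']] := @fresh_seq (W ++ U ++ rcons s a) m uW.
pose z d := v (rcons s d) W'.
pose K : R := m.+1`!%:R / (size s + m.+1)`!%:R.
have sumK c T : size T = m -> uniq (W' ++ c :: T ++ s) ->
    \sum_(d <- c :: T) z d = K.
  move=> Tm uT.
  have ucT : uniq (c :: T ++ s).
    by apply: uniq_count_le uT => x; rewrite /= !count_cat /= !count_cat; lia.
  have <- : v s (c :: T) = K by rewrite IH//= Tm.
  rewrite v_rec//; apply: eq_big_seq => d dT.
  rewrite -[rem d _]cats0 /z -[W']cats0; apply: v_replace.
    by rewrite size_rem//= Wm'.
  have perm_d := perm_to_rem dT.
  apply: uniq_count_le uT => x; rewrite /= ?(count_cat, =^~ cats1) /=.
  move/permP: perm_d => /(_ (pred1 x)) /=; rewrite !count_cat; lia.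
have zaE d : d \in U -> z d = z a.
  move=> dU; have /permP pd := perm_to_rem dU.
  have H1 : \sum_(e <- d :: W) z e = K.
    apply: sumK => //; apply: uniq_count_le uW' => x.
    by have := pd (pred1 x); rewrite /= ?(count_cat, =^~ cats1) /= ?(count_cat, =^~ cats1); lia.
  have H2 : \sum_(e <- a :: W) z e = K.
    apply: sumK => //; apply: uniq_count_le uW' => x.
    by rewrite /= ?(count_cat, =^~ cats1) /= ?(count_cat, =^~ cats1); lia.
  by move: H1; rewrite -H2 !big_cons => /addIr.
have : \sum_(d <- a :: U) z d = K.
  apply: sumK => //; apply: uniq_count_le uW' => x.
  by rewrite /= ?(count_cat, =^~ cats1) /= ?(count_cat, =^~ cats1); lia.
rewrite big_cons (eq_big_seq (fun=> z a))// big_const_seq count_predT iter_addr_0.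
rewrite -mulrS -/m => zK.
have -> : v (rcons s a) U = z a.
  rewrite -[U]cats0 /z -[W' in RHS]cats0; apply: v_replace; first by rewrite Wm'.
  apply: uniq_count_le uW' => x.
  by rewrite /= ?(count_cat, =^~ cats1) /= ?(count_cat, =^~ cats1); lia.
have m0 : m.+1%:R != 0 :> R by rewrite pnatr_eq0.
apply: (mulIf m0); rewrite mulr_natr zK /K size_rcons addSnnS factS natrM.
by rewrite [RHS]mulrAC [m.+1%:R * _]mulrC.
Qed.
End ChainCount.

(** * Chain events in a linear order *)

Lemma measurable_all d (T : measurableType d) (C : Type) (b : C -> T -> bool) l :
  (forall c, measurable_fun setT (b c)) ->
  measurable_fun setT (fun x => all (b^~ x) l).
Proof.
move=> mb; elim: l => [|c l IH]; first exact: measurable_cst.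
exact: measurable_and.
Qed.

Section Chains.
Variable M : countType.
Local Notation T := (Bcube M).

(** The list [U] carries the points still to be ordered above [s]. *)
Definition chain (s U : seq M) (x : T) : bool :=
  pairwise (fun a b => x (a, b)) s && allrel (fun a b => x (a, b)) s U.

Lemma measurable_chain s U : measurable_fun setT (chain s U).
Proof.
apply: measurable_and.
  elim: s => [|a s IH]; first exact: measurable_cst.
  apply: measurable_and => //.
  by apply: (@measurable_all _ _ _ (fun b (x : T) => x (a, b))) => b; exact: measurable_coord.
apply: (@measurable_all _ _ _ (fun a (x : T) => all (fun b => x (a, b)) U)) => a.
by apply: (@measurable_all _ _ _ (fun b (x : T) => x (a, b))) => b; exact: measurable_coord.
Qed.

Lemma chain_act g s U x : chain s U (act_inv g x) = chain (map g s) (map g U) x.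
Proof. by rewrite /chain pairwise_map allrel_mapl allrel_mapr. Qed.

Lemma LO_act g (x : T) : injective g -> LO x -> LO (act_inv g x).
Proof.
move=> gi [ir [tr tot]]; split; first by move=> a; exact: ir.
split=> [a b c|a b ab]; first exact: tr.
by apply: tot; rewrite (inj_eq gi).
Qed.

Section LinearOrder.
Variable x : T.
Hypothesis xLO : LO x.
Let r (a b : M) := x (a, b).

Lemma LO_irr : irreflexive r.
Proof. by move=> a; apply/negbTE; have [ir _] := xLO; exact: ir. Qed.
Lemma LO_trans : transitive r.
Proof. by move=> b a c; case: xLO => _ [tr _]; exact: tr. Qed.
Lemma LO_tot a b : a != b -> r a b || r b a.
Proof. by case: xLO => _ [_ tot]; exact: tot. Qed.

(** By transitivity only the last element of the chain needs comparing with c; this isolates the one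
    factor to which the exchange property applies. *)
Lemma chain_cons s a c U :
  chain (rcons s a) (c :: U) x = x (a, c) && chain (rcons s a) U x.
Proof.
rewrite /chain allrel_consr andbCA; case: (boolP (pairwise _ _)) => [|_] /=;
  last by rewrite !andbF.
rewrite pairwise_rcons => /andP[/allP sa _].
congr (_ && _); rewrite all_rcons; case: (boolP (x (a, c))) => //= ac.
by apply/allP => b /sa ba; exact: (@LO_trans a b c).
Qed.

Lemma LO_min_sum (R : realFieldType) c (U : seq M) : uniq (c :: U) ->
  \sum_(d <- c :: U) (all (r d) (rem d (c :: U)))%:R = 1 :> R.
Proof.
move=> uT; have [d dT dmin] : exists2 d, d \in c :: U &
    forall e, e \in c :: U -> e != d -> r d e.
  elim: U c {uT} => [|c' U IH] c.
    by exists c => [|e]; rewrite inE// => /eqP ->; rewrite eqxx.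
  have [d dU dmin] := IH c'.
  have [cd|dc] := boolP (r c d).
    exists c; first exact: mem_head.
    move=> e; rewrite inE => /predU1P[->|eU ec]; first by rewrite eqxx.
    have [->//|ed] := eqVneq e d.
    exact: LO_trans cd (dmin _ eU ed).
  exists d; first by rewrite inE dU orbT.
  move=> e; rewrite inE => /predU1P[->|eU ed]; last exact: dmin.
  by move=> /LO_tot; rewrite (negPf dc).
rewrite (bigD1_seq d)//= big1_seq => [|e /andP[ed eT]].
  rewrite addr0; have -> : all (r d) (rem d (c :: U)) => //.
  by apply/allP => e; rewrite mem_rem_uniq// inE => /andP[ed eT]; exact: dmin.
have -> // : all (r e) (rem e (c :: U)) = false.
apply/negP => /allP/(_ d); rewrite mem_rem_uniq// inE eq_sym ed => /(_ dT) red.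
by have := LO_trans red (dmin _ eT ed); rewrite LO_irr.
Qed.

(** The left side is multiplied by the sum over d of the indicators that d is least in c :: U, which
    is 1. *)
Lemma chain_rec (R : realFieldType) s c U : uniq (c :: U) ->
  (chain s (c :: U) x)%:R =
  \sum_(d <- c :: U) (chain (rcons s d) (rem d (c :: U)) x)%:R :> R.
Proof.
move=> uT; rewrite -[LHS]mulr1 -[X in _ * X](LO_min_sum R uT) mulr_sumr.
apply: eq_big_seq => d dT; rewrite -natrM mulnb; congr (_%:R); congr nat_of_bool.
rewrite /chain pairwise_rcons -[in RHS]cats1 allrel_catl.
have -> : allrel (fun a b => x (a, b)) s (c :: U) =
    all (r^~ d) s && allrel r s (rem d (c :: U)).
  by rewrite -allrel_consr /allrel; apply: eq_all => a; exact/perm_all/perm_to_rem.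
rewrite allrel1l /r; case: all; case: pairwise; case: allrel; case: all => //.
Qed.

Lemma chain_sort (L : seq M) : uniq L -> exists2 s, s \in permutations L &
  forall s', s' \in permutations L -> chain s' [::] x = (s' == s).
Proof.
(* Sorting asks for a total relation, hence the reflexive closure of the strict order. *)
move=> uL; pose r' a b := (a == b) || r a b.
have r'tot : total r'.
  move=> a b; rewrite /r'; have [//|ab] := eqVneq a b.
  by have /orP[->|->] := LO_tot ab; rewrite ?orbT.
have r'trans : transitive r'.
  move=> b a c /orP[/eqP ->//|ab] /orP[/eqP <-|bc]; rewrite /r' ?ab ?orbT//.
  by rewrite (LO_trans ab bc) orbT.
have srt : sorted r (sort r' L).
  have us : uniq (sort r' L) by rewrite sort_uniq.
  have := sort_sorted r'tot L; rewrite !(sorted_pairwise) //; last exact: LO_trans.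
  elim: (sort r' L) us => //= a s IH /andP[as_ us] /andP[H1 /IH ->//].
  rewrite andbT; apply/allP => b bs; have /orP[/eqP ab|//] := allP H1 _ bs.
  by rewrite ab bs in as_.
exists (sort r' L); first by rewrite mem_permutations perm_sort.
move=> s'; rewrite mem_permutations => s'L.
rewrite /chain allrel0r andbT; apply/idP/eqP => [|->]; last first.
  by rewrite -sorted_pairwise//; exact: LO_trans.
rewrite -sorted_pairwise; last exact: LO_trans.
move=> s's; apply: (irr_sorted_eq LO_trans LO_irr s's srt).
by apply: perm_mem; rewrite perm_sym perm_sort perm_sym.
Qed.

Definition agrees (l : seq ((M * M) * bool)) (s : seq M) :=
  all (fun q => (index q.1.1 s < index q.1.2 s)%N == q.2) l.

Lemma cyl_chain l s : chain s [::] x ->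
  all (fun q => (q.1.1 \in s) && (q.1.2 \in s)) l ->
  all (fun q => x q.1 == q.2) l = agrees l s.
Proof.
rewrite /chain allrel0r andbT => ch /allP ls; apply: eq_in_all => -[[a b] t] /ls /=.
move=> /andP[as_ bs]; congr (_ == _).
have H e f : e \in s -> f \in s -> (index e s < index f s)%N -> r e f.
  move=> es fs ef; have /(pairwiseP e) H := ch.
  have := H (index e s) (index f s); rewrite !inE !index_mem !nth_index//; exact.
have [ab|ba|ab] := ltngtP (index a s) (index b s).
- exact: H.
- apply/negP => xab; have := LO_trans xab (H _ _ bs as_ ba).
  by rewrite LO_irr.
- have -> : a = b by rewrite -(nth_index a as_) ab nth_index.
  exact: LO_irr.
Qed.

(** Exactly one ordering of L is a chain of x, and it decides every constraint of the cylinder.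
    Probabilities of chains therefore determine those of all cylinders. *)
Lemma cyl_expand (R : realFieldType) l (L : seq M) : uniq L ->
  all (fun q => (q.1.1 \in L) && (q.1.2 \in L)) l ->
  (all (fun q => x q.1 == q.2) l)%:R =
  \sum_(s <- permutations L) (agrees l s)%:R * (chain s [::] x)%:R :> R.
Proof.
move=> uL lL; have [s sL sP] := chain_sort uL.
rewrite (bigD1_seq s)//= ?permutations_uniq// big1_seq ?addr0; last first.
  by move=> s' /andP[ss' /sP ->]; rewrite (negPf ss') mulr0.
rewrite sP// eqxx mulr1 (cyl_chain (s := s)) ?sP ?eqxx//.
apply: sub_all lL => q; rewrite mem_permutations in sL.
by rewrite !(perm_mem sL).
Qed.
End LinearOrder.
End Chains.

(** * Probabilities as expectations; the uniform measure on cylinders *)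

Section Expectation.
Context d (T : measurableType d) (R : realType) (P : probability T R).

Lemma Ex_test (b : T -> bool) (mb : measurable_fun setT b) :
  P [set x | b x] = (Ex P (bmf_test R mb))%:E.
Proof.
have mB : measurable [set x | b x].
  by rewrite -[X in measurable X]setTI; exact: (mb measurableT [set true]).
rewrite /Ex /Rintegral.
have -> : (\int[P]_x (bmf_test R mb x)%:E = P [set x | b x])%E.
  have := integral_indic P measurableT mB; rewrite setIT => <-.
  apply: eq_integral => x _; rewrite indicE /=; congr ((nat_of_bool _)%:R%:E).
  by apply/idP/idP => [/mem_set|/set_mem].
by rewrite fineK// fin_num_measure.
Qed.

Lemma Ex_sum (I : eqType) (l : seq I) (F : I -> bmf T R) (f : bmf T R) :
  {ae P, forall x, f x = \sum_(i <- l) F i x} ->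
  Ex P f = \sum_(i <- l) Ex P (F i).
Proof.
move=> fF.
transitivity (Ex P (\sum_(i <- l) F i : bmf T R)).
  apply: Ex_ae; apply: filterS fF => x ->.
  by apply/esym/(big_morph (fun g : bmf T R => g x)).
apply: (big_morph (fun g : bmf T R => Ex P g)) => [g h|]; first exact: ExD.
exact: (Ex_cst P 0).
Qed.
End Expectation.

Section Uniform.
Variables (M : countType) (R : realType).
Local Notation T := (Bcube M).

Definition chain_fun s U : bmf T R := bmf_test R (@measurable_chain M s U).

Section OnLO.
Variable mu : probability T R.
Hypothesis muLO : on_LO mu.

Lemma probability_LOI B : measurable B -> mu (@LO M `&` B) = mu B.
Proof.
move=> mB; have mLO := @measurable_LO M.
have -> : mu B = (mu (B `\` @LO M) + mu (B `&` @LO M))%E by rewrite -measureDI.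
rewrite setIC [X in (X + _)%E](_ : _ = 0%E) ?add0e//.
apply/eqP; rewrite eq_le measure_ge0 andbT -(nu_setC_LO muLO).
by apply: le_measure; rewrite ?inE; [exact: measurableD|exact: measurableC|move=> x []].
Qed.

Lemma uniform_event k (a : 'I_k -> M) (m : M) :
  mu [set x | LO x /\ forall i j : 'I_k, (i < j)%N -> x (a i, a j)] =
  (Ex mu (chain_fun [seq a i | i <- enum 'I_k] [::]))%:E.
Proof.
set s := [seq a i | i <- enum 'I_k].
have mc : measurable [set x : T | chain s [::] x].
  rewrite -[X in measurable X]setTI.
  exact: (@measurable_chain M s [::] measurableT [set true]).
rewrite -Ex_test -(probability_LOI mc); congr (mu _).
have szs : size s = k by rewrite size_map size_enum_ord.
have ns (i : 'I_k) : nth m s i = a i.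
  by rewrite (nth_map i) ?size_enum_ord// nth_ord_enum.
apply/seteqP; split => x /= [xLO H]; split => //.
  rewrite /chain allrel0r andbT; apply/(pairwiseP m) => i j.
  rewrite !inE szs => ik jk ij.
  by have := H (Ordinal ik) (Ordinal jk) ij; rewrite -!ns.
move: H; rewrite /chain allrel0r andbT => /(pairwiseP m) H i j ij.
by rewrite -!ns; apply: H; rewrite ?inE ?szs.
Qed.

Definition chain_uniform :=
  forall s : seq M, uniq s -> Ex mu (chain_fun s [::]) = (size s)`!%:R^-1.

Lemma chain_uniformP (m : M) : chain_uniform <-> is_uniform mu.
Proof.
split=> [H|[_ H] s us].
  split=> // k a a_inj; rewrite (uniform_event _ m) H.
    by rewrite size_map size_enum_ord.
  by rewrite map_inj_uniq// enum_uniq.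
have /tuple_uniqP t_inj : uniq (in_tuple s) by [].
have := H _ (tnth (in_tuple s)) t_inj.
by rewrite (uniform_event _ m) map_tnth_enum => -[].
Qed.

(** The value depends neither on g nor on the measure: a general g yields invariance, and g = id
    yields equality of any two measures uniform on chains. *)
Lemma uniform_cyl g l : chain_uniform -> injective g ->
  mu (@act_inv M g @^-1` (cyl l)) =
  (let L := undup (flatten [seq [:: q.1.1; q.1.2] | q <- l]) in
   \sum_(s <- permutations L) (agrees l s)%:R / (size L)`!%:R)%:E.
Proof.
move=> mu_unif g_inj; set L := undup _ => /=.
have uL : uniq L by exact: undup_uniq.
have lL : all (fun q => (q.1.1 \in L) && (q.1.2 \in L)) l.
  apply/allP => q ql; rewrite !mem_undup; apply/andP.
  by split; apply/flatten_mapP; exists q => //; rewrite !inE eqxx ?orbT.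
have mb : measurable_fun setT
    (fun x : T => all (fun q => act_inv g x q.1 == q.2) l).
  apply: (measurable_fun_bool true).
  exact: (@measurable_act M g measurableT _ (measurable_cyl l)).
rewrite [X in mu X](_ : _ = [set x | all (fun q => act_inv g x q.1 == q.2) l])//.
rewrite (Ex_test mu mb); congr EFin.
rewrite (@Ex_sum _ _ _ mu _ (permutations L)
  (fun s => (agrees l s)%:R *: chain_fun (map g s) [::])).
  apply: eq_big_seq => s; rewrite mem_permutations => sL.
  have -> : Ex mu ((agrees l s)%:R *: chain_fun (map g s) [::]) =
    (agrees l s)%:R * Ex mu (chain_fun (map g s) [::]) by exact: ExZ.
  by rewrite mu_unif ?size_map ?(perm_size sL)// map_inj_uniq// (perm_uniq sL).
apply: filterS (ae_LO muLO) => x xLO.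
rewrite /= (cyl_expand (LO_act g_inj xLO) R uL lL).
by apply: eq_bigr => s _; rewrite chain_act.
Qed.
End OnLO.
End Uniform.

(** * Uniqueness of the invariant measure *)

Section InvariantUniform.
Variables (M : countType) (G : set (M -> M)).
Hypotheses (G1 : G id) (GM : forall g h, G g -> G h -> G (g \o h)).
Hypothesis GV : forall g, G g -> exists h, [/\ G h, g \o h = id & h \o g = id].
Hypotheses (M0 : exists m : M, True) (oligo : finitely_many_orbits G).
Hypotheses (noalg : no_algebraicity G) (wei : weak_EI G).
Hypothesis trans : transitive_action G.
Variables (R : realType) (nu : probability (Bcube M) R).
Hypotheses (nuLO : on_LO nu) (nuG : G_invariant G nu).
Hypothesis no_order : ~ exists x, LO x /\ fixed_point G x.

Lemma ae_fixed_chain (s U : seq M) : ae_fixed G nu (U ++ s) (chain_fun R s U).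
Proof.
move=> g [_ gUs]; apply: aeW => x; rewrite /= chain_act.
by rewrite !map_id_in// => z zs; apply: gUs; rewrite mem_cat zs ?orbT.
Qed.

Lemma invariant_chain_uniform : chain_uniform nu.
Proof.
move=> s us.
have fresh (L : seq M) : exists b : M, b \notin L := avoid_seq noalg L M0.
rewrite (@chain_count _ _ (fun s U => Ex nu (chain_fun R s U)) fresh _ _ _ _ s [::]).
- by rewrite addn0 fact0 div1r.
- move=> U; rewrite -[RHS](Ex_cst nu 1).
  by apply: (@Ex_ae _ _ _ nu _ (bmf_cst _ 1)); exact: aeW.
- move=> t c U uU; apply: (@Ex_sum _ _ _ nu _ (c :: U)
    (fun d => chain_fun R (rcons t d) (rem d (c :: U)))).
  apply: filterS (ae_LO nuLO) => x xLO; apply: chain_rec => //.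
  by move: uU; rewrite -cat_cons cat_uniq => /andP[].
(* The exchange property is applied to 1[a < c] against the indicator of the remaining chain event,
   which is fixed by the stabiliser of all points other than c. *)
- have key t a c U : c \notin U ++ rcons t a ->
      Ex nu (chain_fun R (rcons t a) (c :: U)) =
      inner nu (lt_fun R a c) (chain_fun R (rcons t a) U).
    move=> cU; apply: (@Ex_ae _ _ _ nu _ (bmf_mul _ _)).
    apply: filterS (ae_LO nuLO) => x xLO.
    by rewrite /= chain_cons// -mulnb natrM.
  move=> t a c c' U /= /andP[cU _] /andP[c'U _].
  rewrite !key//.
  have ne e : e \notin U ++ rcons t a -> a != e.
    by apply: contraNneq => <-; rewrite mem_cat mem_rcons mem_head orbT.
  apply: (exchange G1 GM GV M0 oligo noalg wei trans nuLO nuG no_order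
    (ne _ cU) (ne _ c'U) cU c'U).
  exact: ae_fixed_chain.
- move=> t U U' UU'; congr Ex; apply/funext => x /=; congr ((nat_of_bool _)%:R).
  by congr (_ && _); apply: eq_all => a; exact: perm_all.
- by rewrite cat0s.
Qed.
End InvariantUniform.

(** * The dichotomy for automorphism groups *)

Lemma Aut_id (M : countType) (I : Type) (ar : I -> nat)
  (Rel : forall i, ('I_(ar i) -> M) -> Prop) : Aut Rel id.
Proof. by split => //; exists id. Qed.

Lemma Aut_comp (M : countType) (I : Type) (ar : I -> nat)
  (Rel : forall i, ('I_(ar i) -> M) -> Prop) g h :
  Aut Rel g -> Aut Rel h -> Aut Rel (g \o h).
Proof.
move=> [bg Rg] [bh Rh]; split; first exact: bij_comp.
by move=> i t; rewrite -compA Rg Rh.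
Qed.

Lemma Aut_inv (M : countType) (I : Type) (ar : I -> nat)
  (Rel : forall i, ('I_(ar i) -> M) -> Prop) g : Aut Rel g ->
  exists h, [/\ Aut Rel h, g \o h = id & h \o g = id].
Proof.
move=> [[h gh hg] Rg]; exists h; split; last 2 first.
- by apply/funext.
- by apply/funext.
split=> [|i t]; first by exists g.
by rewrite -Rg compA (_ : g \o h = id)//; apply/funext.
Qed.

Lemma preimage_act_id (M : countType) (A : set (Bcube M)) :
  @act_inv M id @^-1` A = A.
Proof.
have aid (x : Bcube M) : act_inv id x = x by apply/funext => -[].
by apply/seteqP; split => x /=; rewrite aid.
Qed.

Theorem theorem1p2 (M : countType) (I : Type) (ar : I -> nat)
  (Rel : forall i, ('I_(ar i) -> M) -> Prop) (R : realType)
  (mu_u : probability (Bcube M) R) :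
  (exists m : M, True) ->
  transitive_action (Aut Rel) ->
  finitely_many_orbits (Aut Rel) ->
  no_algebraicity (Aut Rel) ->
  weak_EI (Aut Rel) ->
  is_uniform mu_u ->
  let P1 := exists x, @LO M x /\ fixed_point (Aut Rel) x in
  let P2 := G_invariant (Aut Rel) mu_u /\
            forall nu : probability (Bcube M) R,
              on_LO nu -> G_invariant (Aut Rel) nu ->
              forall A : set (Bcube M), measurable A -> nu A = mu_u A in
  (P1 /\ ~ P2) \/ (~ P1 /\ P2).
Proof.
move=> M0 trans oligo noalg wei mu_unif P1 P2.
have [m _] := M0.
have muLO : on_LO mu_u by case: mu_unif.
have mu_ch : chain_uniform mu_u by apply/(chain_uniformP muLO m).
have [p1|np1] := pselect P1; [left|right]; split => //.
  move=> [_ uniq_mu]; have [x0 [x0LO x0fix]] := p1.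
  (* The fixed order yields a second invariant measure, which takes only the values 0 and 1, while
     [mu_u] gives 1/2 to a two-point chain. *)
  pose nu : probability (Bcube M) R := dirac x0.
  have nuLO : on_LO nu.
    by rewrite /on_LO /nu /= diracE mem_set.
  have nuG : G_invariant (Aut Rel) nu.
    move=> g Gg A _ _; rewrite /nu /= !diracE; congr ((nat_of_bool _)%:R%:E).
    by apply/idP/idP => /set_mem H; apply/mem_set; move: H => /=; rewrite x0fix.
  have [b bm] := avoid_seq noalg [:: m] M0.
  have us : uniq [:: m; b] by rewrite /= andbT inE eq_sym -[_ == _](mem_seq1 b m).
  have := mu_ch _ us.
  have mc : measurable [set x : Bcube M | chain [:: m; b] [::] x].
    rewrite -[X in measurable X]setTI.
    exact: (@measurable_chain M _ _ measurableT [set true]).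
  have := uniq_mu nu nuLO nuG _ mc.
  rewrite (Ex_test mu_u (@measurable_chain M [:: m; b] [::])) /nu /= diracE => -[<-].
  by case: (_ \in _); rewrite /= !factS fact0; lra.
split.
  move=> g Gg A mA _.
  have gi := G_inj (@Aut_inv _ _ _ Rel) Gg.
  (* The pushforward by g is compared with [mu_u] on cylinders, which form a generating family
     closed under intersection. *)
  suff H : forall B, measurable B -> pushforward mu_u (@act_inv M g) B = mu_u B.
    exact: H.
  apply: measure_cyl_unique; first exact: measurable_act.
    move=> mg; rewrite -[ltLHS]/(mu_u (@act_inv M g @^-1` setT)) preimage_setT.
    by apply: (le_lt_trans (probability_le1 mu_u _)) => //; exact: ltry.
  move=> mg l; rewrite -[LHS]/(mu_u (@act_inv M g @^-1` cyl l)) (uniform_cyl muLO l mu_ch gi).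
  by rewrite -(uniform_cyl muLO l mu_ch (@inj_id M)) preimage_act_id.
move=> nu nuLO nuG A mA.
have nu_ch := invariant_chain_uniform (@Aut_id _ _ _ Rel) (@Aut_comp _ _ _ Rel)
  (@Aut_inv _ _ _ Rel) M0 oligo noalg wei trans nuLO nuG np1.
apply: (measure_cyl_unique _ _ mA).
  by apply: (le_lt_trans (probability_le1 nu _)) => //; exact: ltry.
move=> l; have := uniform_cyl nuLO l nu_ch (@inj_id M).
by rewrite -(uniform_cyl muLO l mu_ch (@inj_id M)) preimage_act_id.
Qed.
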